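(* Let $(G,J)$ be a $2n$-dimensional simply connected solvable unimodular Lie group with a left invariant complex structure, with Lie algebra $\mathfrak{g}$ and Koszul $1$-form $\psi\in\mathfrak{g}^*$. Assume that $\psi\not\equiv0$ and $\psi([\mathfrak{g},\mathfrak{g}])=0$, and let $\mathfrak{h}=\operatorname{Ker}\psi$, so that $\mathfrak{g}=\mathbb{R}e_0\ltimes\mathfrak{h}$ and consequently $G=\mathbb{R}\ltimes H$, where $H$ is the unique connected normal subgroup of $G$ with $\operatorname{Lie}(H)=\mathfrak{h}$. Then the $(n,0)$-form $$\tau=\exp\!\left(-\tfrac{i}{2}\operatorname{Tr}(J\operatorname{ad}e_0)\,t\right)\sigma$$ on $G$ is closed, where $t$ is the coordinate of $\mathbb{R}$ and $\sigma$ is a left invariant $(n,0)$-form.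
   Context: The Koszul $1$-form is $\psi(x)=\operatorname{Tr}(J\operatorname{ad}x)-\operatorname{Tr}\operatorname{ad}(Jx)$, $x\in\mathfrak{g}$ (with $J$ also denoting the induced endomorphism of $\mathfrak{g}$). $G$ is unimodular if $\operatorname{Tr}(\operatorname{ad}x)=0$ for all $x\in\mathfrak{g}$. Here $e_0\in\mathfrak{g}$ spans a complement of the ideal $\mathfrak{h}$, the factor $\mathbb{R}$ in $G=\mathbb{R}\ltimes H$ is the one-parameter subgroup $t\mapsto\exp(te_0)$, and $t:G\to\mathbb{R}$ is the corresponding coordinate; thus $dt$ is the left invariant $1$-form $e^0$ with $e^0(e_0)=1$ and $e^0|_{\mathfrak{h}}=0$. A complex $1$-form $\gamma$ is of type $(1,0)$ if $\gamma(J\cdot)=i\gamma(\cdot)$. *)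

(* Defs.v *)
From HB Require Import structures.
From mathcomp Require Import all_boot all_order all_algebra.
From mathcomp Require Import monoid complex.
From mathcomp Require Import all_classical all_reals all_analysis.

Set Implicit Arguments.
Unset Strict Implicit.
Unset Printing Implicit Defensive.

Import Order.TTheory GRing.Theory Num.Theory.
Import numFieldNormedType.Exports.

Local Open Scope classical_set_scope.
Local Open Scope ring_scope.

(** In finite dimension, [f] is C^(k+1) on the open set [U] iff it is
    differentiable on [U] and all its directional derivatives are C^k on [U]. *)

Fixpoint Ck (R : realType) (V W : normedModType R) (k : nat)
    (U : set V) (f : V -> W) : Prop :=
  match k with
  | 0 => forall x, U x -> {for x, continuous f}
  | k'.+1 => (forall x, U x -> differentiable f x) /\
             (forall v, Ck k' U (fun x => 'D_v f x))
  end.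

Definition Cinf (R : realType) (V W : normedModType R)
    (U : set V) (f : V -> W) : Prop := forall k, Ck k U f.

(** The atlas is indexed by the points of the manifold: [chart p] is a chart
    defined on the open neighbourhood [chart_dom p] of [p], and [unchart p] is
    its inverse.  Outside of their domains these functions are meaningless. *)

HB.mixin Record isManifold (R : realType) (m : nat) M & Topological M := {
  chart_dom : M -> set M;
  chart : M -> M -> 'rV[R]_m;
  unchart : M -> 'rV[R]_m -> M;
  hausdorff_manifold : hausdorff_space M;
  second_countable_manifold : @second_countable M;
  chart_dom_self : forall p, chart_dom p p;
  chart_dom_open : forall p, open (chart_dom p);
  chart_image_open : forall p, open (chart p @` chart_dom p);
  chartK : forall p x, chart_dom p x -> unchart p (chart p x) = x;
  chart_continuous :
    forall p x, chart_dom p x -> {for x, continuous (chart p)};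
  unchart_continuous :
    forall p y, (chart p @` chart_dom p) y -> {for y, continuous (unchart p)};
  chart_transition : forall p q,
    Cinf (chart p @` (chart_dom p `&` chart_dom q)) (chart q \o unchart p)
}.

#[short(type="manifoldType")]
HB.structure Definition Manifold (R : realType) (m : nat) :=
  {M of Topological M & isManifold R m M}.

Definition chart_image (R : realType) (m : nat) (M : manifoldType R m) (p : M)
  : set 'rV[R]_m := chart p @` chart_dom p.

Definition smooth_map (R : realType) (m n : nat)
    (M : manifoldType R m) (N : manifoldType R n) (f : M -> N) : Prop :=
  continuous f /\
  forall p q, Cinf (chart_image p `&` [set x | chart_dom q (f (unchart p x))])
                   (chart q \o f \o unchart p).

Definition smooth_fun (R : realType) (m : nat) (M : manifoldType R m)
    (W : normedModType R) (f : M -> W) : Prop :=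
  forall p, Cinf (chart_image p) (f \o unchart p).

Definition smooth_curve (R : realType) (m : nat) (M : manifoldType R m)
    (c : R -> M) : Prop :=
  continuous c /\
  forall p, Cinf [set s : R^o | chart_dom p (c s)] (chart p \o c : R^o -> _).

(** The tangent space at [p] is identified with the space ['rV[R]_m] of row
    vectors by means of the chart [chart p]; the differential of a map acts on
    tangent vectors by right multiplication by a Jacobian matrix. *)

Definition velocity (R : realType) (m : nat) (M : manifoldType R m)
    (c : R -> M) (s : R) : 'rV[R]_m :=
  derive1 (chart (c s) \o c) s.

Definition tangent_map (R : realType) (m n : nat)
    (M : manifoldType R m) (N : manifoldType R n) (f : M -> N) (p : M)
  : 'M[R]_(m, n) :=
  jacobian (chart (f p) \o f \o unchart p) (chart p p).

(** Differential at [q] of [chart p], from the tangent space at [q] to R^m. *)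
Definition dchart (R : realType) (m : nat) (M : manifoldType R m) (p q : M)
  : 'M[R]_m :=
  jacobian (chart p \o unchart q) (chart q q).

(** Differential at [x] of [unchart p], from R^m to the tangent space at
    [unchart p x]. *)
Definition dunchart (R : realType) (m : nat) (M : manifoldType R m) (p : M)
    (x : 'rV[R]_m) : 'M[R]_m :=
  jacobian (chart (unchart p x) \o unchart p) x.

Definition vfield_in_chart (R : realType) (m : nat) (M : manifoldType R m)
    (X : M -> 'rV[R]_m) (p : M) (x : 'rV[R]_m) : 'rV[R]_m :=
  X (unchart p x) *m dchart p (unchart p x).

Definition smooth_vfield (R : realType) (m : nat) (M : manifoldType R m)
    (X : M -> 'rV[R]_m) : Prop :=
  forall p, Cinf (chart_image p) (vfield_in_chart X p).

Definition vfield_bracket (R : realType) (m : nat) (M : manifoldType R m)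
    (X Y : M -> 'rV[R]_m) (p : M) : 'rV[R]_m :=
  'D_(X p) (vfield_in_chart Y p) (chart p p)
  - 'D_(Y p) (vfield_in_chart X p) (chart p p).

(** [J p], acting on the right, is the endomorphism of the tangent space at
    [p]; integrability is the vanishing of the Nijenhuis tensor. *)

Definition vfield_mul (R : realType) (m : nat) (M : manifoldType R m)
    (J : M -> 'M[R]_m) (X : M -> 'rV[R]_m) : M -> 'rV[R]_m :=
  fun p => X p *m J p.

Definition nijenhuis (R : realType) (m : nat) (M : manifoldType R m)
    (J : M -> 'M[R]_m) (X Y : M -> 'rV[R]_m) (p : M) : 'rV[R]_m :=
  let JX := vfield_mul J X in
  let JY := vfield_mul J Y in
  vfield_bracket X Y p
  + (vfield_bracket JX Y p + vfield_bracket X JY p) *m J p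
  - vfield_bracket JX JY p.

Definition complex_structure (R : realType) (m : nat) (M : manifoldType R m)
    (J : M -> 'M[R]_m) : Prop :=
  [/\ forall p, Cinf (chart_image p)
        (fun x => dunchart p x *m J (unchart p x) *m dchart p (unchart p x)),
      forall p, J p *m J p = - 1%:M
    & forall X Y, smooth_vfield X -> smooth_vfield Y ->
        forall p, nijenhuis J X Y p = 0].

(** The [k] arguments of a form are the rows of a [k x m] matrix. *)

Definition alternating_form (R : realType) (k m : nat)
    (w : 'M[R]_(k, m) -> R[i]) : Prop :=
  (forall (A B C : 'M[R]_(k, m)) (i : 'I_k) (b c : R),
     row i A = b *: row i B + c *: row i C ->
     row' i B = row' i A -> row' i C = row' i A ->
     w A = (b%:C * w B + c%:C * w C)%C) /\
  (forall (A : 'M[R]_(k, m)) (i j : 'I_k),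
     i != j -> row i A = row j A -> w A = 0).

(** Pull-back of [w] by [unchart p]. *)
Definition form_in_chart (R : realType) (k m : nat) (M : manifoldType R m)
    (w : M -> 'M[R]_(k, m) -> R[i]) (p : M) (x : 'rV[R]_m)
    (A : 'M[R]_(k, m)) : R[i] :=
  w (unchart p x) (A *m dunchart p x).

Definition smooth_form (R : realType) (k m : nat) (M : manifoldType R m)
    (w : M -> 'M[R]_(k, m) -> R[i]) : Prop :=
  (forall p, alternating_form (w p)) /\
  (forall p A,
     Cinf (chart_image p) (fun x => complex.Re (form_in_chart w p x A) : R^o) /\
     Cinf (chart_image p) (fun x => complex.Im (form_in_chart w p x A) : R^o)).

Definition cderive (R : realType) (V : normedModType R) (f : V -> R[i])
    (x v : V) : R[i] :=
  ('D_v (fun y => complex.Re (f y) : R^o) x +i*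
   'D_v (fun y => complex.Im (f y) : R^o) x)%C.

(** Exterior derivative: in a chart, d w (v_0, ..., v_k) is the alternating sum
    of the derivatives of w (v_0, ..., v_(i-1), v_(i+1), ..., v_k) along v_i. *)
Definition ext_derivative (R : realType) (k m : nat) (M : manifoldType R m)
    (w : M -> 'M[R]_(k, m) -> R[i]) (p : M) (A : 'M[R]_(k.+1, m)) : R[i] :=
  \sum_(i < k.+1)
     (-1) ^+ i * cderive (fun x => form_in_chart w p x (row' i A))
                         (chart p p) (row i A).

Definition closed_form (R : realType) (k m : nat) (M : manifoldType R m)
    (w : M -> 'M[R]_(k, m) -> R[i]) : Prop :=
  forall p A, ext_derivative w p A = 0.

(** A [k]-form is of type (k, 0) when it takes the factor i out of [J] in each
    of its arguments. *)
Definition type_k0 (R : realType) (k m : nat) (M : manifoldType R m)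
    (J : M -> 'M[R]_m) (w : M -> 'M[R]_(k, m) -> R[i]) : Prop :=
  forall p (A B : 'M[R]_(k, m)) (i : 'I_k),
    row i B = row i A *m J p -> row' i B = row' i A ->
    w p B = ('i * w p A)%C.

Definition path_connected_space (R : realType) (T : topologicalType) : Prop :=
  forall x y : T, exists f : R -> T,
    [/\ {within `[0, 1], continuous f}, f 0 = x & f 1 = y].

(** Every loop is homotopic, relative to its end points, to a constant loop. *)
Definition simply_connected (R : realType) (T : topologicalType) : Prop :=
  path_connected_space R T /\
  forall f : R -> T, {within `[0, 1], continuous f} -> f 0 = f 1 ->
    exists F : R * R -> T,
      [/\ {within `[0, 1] `*` `[0, 1], continuous F},
          forall s, s \in `[0, 1] -> F (0, s) = f s,
          forall s, s \in `[0, 1] -> F (1, s) = f 0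
        & forall u, u \in `[0, 1] -> F (u, 0) = f 0 /\ F (u, 1) = f 0].

Section AbstractGroups.
Local Open Scope group_scope.

Definition subgroup (G : groupType) (H : set G) : Prop :=
  [/\ H 1, forall x y, H x -> H y -> H (x * y) & forall x, H x -> H x^-1].

Definition normal_subgroup (G : groupType) (H : set G) : Prop :=
  subgroup H /\ forall g x, H x -> H (g * x * g^-1).

Definition generated_subgroup (G : groupType) (A : set G) : set G :=
  [set x | forall K : set G, subgroup K -> A `<=` K -> K x].

Fixpoint derived_series (G : groupType) (k : nat) : set G :=
  match k with
  | 0 => setT
  | k'.+1 => generated_subgroup
      [set z | exists x y : G,
         [/\ derived_series k' x, derived_series k' y & z = [~ x, y]]]
  end.

Definition solvable_group (G : groupType) : Prop :=
  exists k, derived_series k = [set (1 : G)].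

End AbstractGroups.

HB.mixin Record isLieGroup (R : realType) (m : nat) G
    & Manifold R m G & Group G := {
  mulg_continuous : continuous (fun z : G * G => (z.1 * z.2)%g);
  mulg_smooth : forall p q r : G,
    Cinf (V := ('rV[R]_m * 'rV[R]_m)%type)
      [set z | [/\ chart_image p z.1, chart_image q z.2
                 & chart_dom r (unchart p z.1 * unchart q z.2)%g]]
      (fun z => chart r (unchart p z.1 * unchart q z.2)%g);
  invg_smooth : @smooth_map R m m G G (fun x : G => x^-1%g)
}.

#[short(type="lieGroupType")]
HB.structure Definition LieGroup (R : realType) (m : nat) :=
  {G of Manifold R m G & Group G & isLieGroup R m G}.

Definition dleft (R : realType) (m : nat) (G : lieGroupType R m) (g p : G)
  : 'M[R]_m := tangent_map (fun x : G => (g * x)%g) p.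

(** The Lie algebra of [G] is its tangent space ['rV[R]_m] at the identity,
    with the bracket of left invariant vector fields. *)
Definition left_vfield (R : realType) (m : nat) (G : lieGroupType R m)
    (v : 'rV[R]_m) : G -> 'rV[R]_m :=
  fun g => v *m dleft g 1%g.

Definition lie_bracket (R : realType) (m : nat) (G : lieGroupType R m)
    (v w : 'rV[R]_m) : 'rV[R]_m :=
  vfield_bracket (left_vfield (G := G) v) (left_vfield w) 1%g.

(** Only meaningful when [f] is linear. *)
Definition endo_trace (R : realType) (m : nat) (f : 'rV[R]_m -> 'rV[R]_m) : R :=
  \tr (lin1_mx f).

Definition unimodular (R : realType) (m : nat) (G : lieGroupType R m) : Prop :=
  forall x : 'rV[R]_m, endo_trace (lie_bracket G x) = 0.

Definition left_invariant_endo (R : realType) (m : nat) (G : lieGroupType R m)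
    (J : G -> 'M[R]_m) : Prop :=
  forall g p, J p *m dleft g p = dleft g p *m J (g * p)%g.

Definition left_invariant_form (R : realType) (k m : nat)
    (G : lieGroupType R m) (w : G -> 'M[R]_(k, m) -> R[i]) : Prop :=
  forall g p A, w (g * p)%g (A *m dleft g p) = w p A.

(** [trJad J x] is Tr (J ad x). *)
Definition trJad (R : realType) (m : nat) (G : lieGroupType R m)
    (J : G -> 'M[R]_m) (x : 'rV[R]_m) : R :=
  endo_trace (fun y => lie_bracket G x y *m J 1%g).

Definition koszul (R : realType) (m : nat) (G : lieGroupType R m)
    (J : G -> 'M[R]_m) (x : 'rV[R]_m) : R :=
  trJad J x - endo_trace (lie_bracket G (x *m J 1%g)).

(** [c] is the one-parameter subgroup s |-> exp (s v). *)
Definition one_parameter_subgroup (R : realType) (m : nat)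
    (G : lieGroupType R m) (v : 'rV[R]_m) (c : R -> G) : Prop :=
  [/\ smooth_curve c, forall s u, c (s + u) = (c s * c u)%g
    & velocity c 0 = v].

(** Lie algebra of a subgroup [H]: the [v] with exp (s v) in [H] for all s. *)
Definition lie_algebra_of (R : realType) (m : nat) (G : lieGroupType R m)
    (H : set G) : set 'rV[R]_m :=
  [set v | exists c, one_parameter_subgroup v c /\ forall s, H (c s)].

(** [t] is the coordinate of R in the decomposition G = R |x H, where the
    factor R is the one-parameter subgroup [c]: the map (s, h) |-> c s * h is a
    bijection from R x H to G, and [t] is the first component of its inverse. *)
Definition semidirect_coordinate (R : realType) (m : nat)
    (G : lieGroupType R m) (c : R -> G) (H : set G) (t : G -> R) : Prop :=
  [/\ smooth_fun (t : G -> R^o),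
      forall g, H ((c (t g))^-1 * g)%g
    & forall s h, H h -> t (c s * h)%g = s].

Definition cexp (R : realType) (z : R[i]) : R[i] :=
  let: (x +i* y)%C := z in ((expR x * cos y) +i* (expR x * sin y))%C.

(* Main.v *)
(** For [u] in the Lie algebra put [B_u = ad u + J ad (Ju)]; integrability says
    that [B_u] commutes with [J].  Contracting [d sigma] with the (0,1)-vector
    [u + i Ju] kills every term of the Cartan formula except
    [- sum_j sigma (.., B_u v_j, ..) = - tr_C (B_u) sigma], and unimodularity gives
    [tr_C (B_u) = - i/2 (psi u + i psi (Ju))].  As [psi = Tr (J ad e_0) dt], this is
    cancelled by the derivative of the exponential factor, so [d tau] is of type
    (n+1,0), hence zero.

    The Cartan formula is obtained in a chart at each point [p] by differentiating
    [sigma (V F(x)) = const], where [F] is the matrix of the left invariant frame;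
    the antisymmetric part of [dF] is the bracket at [p], which is the left
    translate of the bracket at [1] by the symmetry of second derivatives.  The
    differential of [t] is found from its being a homomorphism that vanishes on
    the one-parameter subgroups of [H]. *)

(* The coordinate derivative [D] in the chart at [p] is a torsion-free connection, and the exterior
   derivative is its antisymmetrization. In the left invariant frame sigma has constant
   coefficients, so [D_u sigma] is the derivation induced by an endomorphism [N u] with
   [v N u = - D_u v]. [N] depends on the chart, but torsion-freeness, [v ad u = u N v - v N u], does
   not see this choice. Once it is known at every [p], the differential identity becomes a statement
   about one vector space, with [N] an unknown constrained by that equation. Matrices act on rows
   from the right: [v *m ad u] is [[u, v]]. The arguments stay real and only the values are complex:
   contracting with [u + i Ju] amounts to comparing the values at [Ju] and at [u], and a form of
   type (n+1,0) vanishes because n+1 real vectors are dependent over [C] by way of [J]. *)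
Require Import Defs.
From HB Require Import structures.
From mathcomp Require Import all_boot all_order all_algebra.
From mathcomp Require Import fingroup perm monoid complex ring.
From mathcomp Require Import all_classical all_reals all_analysis.
Import Order.TTheory GRing.Theory Num.Theory.
Import numFieldNormedType.Exports.
Local Open Scope classical_set_scope.
Local Open Scope ring_scope.

(** * Alternating forms *)

Section Alternating.
Context {R : realType}.
Local Notation C := R[i].

Definition setrow {k m : nat} (i : 'I_k) (x : 'rV[R]_m) (A : 'M[R]_(k, m)) :=
  \matrix_(a, b) (if a == i then x 0 b else A a b).

Lemma row_setrow {k m} i x (A : 'M[R]_(k, m)) : row i (setrow i x A) = x.
Proof. by apply/rowP => j; rewrite !mxE eqxx. Qed.

Lemma row_setrow_neq {k m} i j x (A : 'M[R]_(k, m)) :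
  j != i -> row j (setrow i x A) = row j A.
Proof. by move=> ji; apply/rowP => b; rewrite !mxE (negPf ji). Qed.

Lemma row'_setrow {k m} i x (A : 'M[R]_(k, m)) : row' i (setrow i x A) = row' i A.
Proof. by apply/matrixP => a b; rewrite !mxE eq_sym (negPf (neq_lift _ _)). Qed.

Lemma setrow_row {k m} i (A B : 'M[R]_(k, m)) :
  row' i B = row' i A -> setrow i (row i B) A = B.
Proof.
move=> /matrixP e; apply/matrixP => a b; rewrite !mxE.
case: eqP => [->//|/eqP ai].
have [a' ->|ea] := unliftP i a; last by rewrite ea eqxx in ai.
by have := e a' b; rewrite !mxE.
Qed.

Lemma setrow_id {k m} i (A : 'M[R]_(k, m)) : setrow i (row i A) A = A.
Proof. exact: setrow_row. Qed.

Lemma setrowK {k m} i x y (A : 'M[R]_(k, m)) :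
  setrow i x (setrow i y A) = setrow i x A.
Proof. by apply/matrixP => a b; rewrite !mxE; case: eqP. Qed.

Lemma setrowC {k m} i j x y (A : 'M[R]_(k, m)) : i != j ->
  setrow i x (setrow j y A) = setrow j y (setrow i x A).
Proof.
move=> ij; apply/matrixP => a b; rewrite !mxE.
by case: (eqVneq a i) => // ->; rewrite (negPf ij).
Qed.

Lemma setrow0E {k m} (x : 'rV[R]_m) (A : 'M[R]_(k.+1, m)) :
  setrow ord0 x A = (col_mx x (row' ord0 A) : 'M[R]_(1 + k, m)).
Proof.
apply/matrixP => a b; rewrite !mxE; case: splitP => j aj.
  have -> : a = ord0 by apply/val_inj; rewrite /= aj ord1.
  by rewrite eqxx ord1.
have -> : (a == ord0) = false by apply/eqP => e; rewrite e in aj.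
by rewrite mxE; congr (A _ _); apply/val_inj; rewrite /= aj.
Qed.

Lemma row'_ord0_col_mx {k m} (x : 'rV[R]_m) (V : 'M[R]_(k, m)) :
  row' ord0 (col_mx x V : 'M[R]_(1 + k, m)) = V.
Proof.
apply/matrixP => a b; rewrite !mxE; case: splitP => j /= aj.
  by have := ltn_ord j; rewrite -aj.
by congr (V _ _); apply/val_inj; move: aj => /= -[].
Qed.

Lemma setrow0_col_mx {k m} (x u : 'rV[R]_m) (V : 'M[R]_(k, m)) :
  setrow ord0 x (col_mx u V : 'M[R]_(1 + k, m)) = col_mx x V.
Proof. by rewrite setrow0E row'_ord0_col_mx. Qed.

Lemma setrow_lift_col_mx {k m} i (x u : 'rV[R]_m) (V : 'M[R]_(k, m)) :
  setrow (lift ord0 i) x (col_mx u V : 'M[R]_(1 + k, m)) =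
  (col_mx u (setrow i x V) : 'M[R]_(1 + k, m)).
Proof.
apply/matrixP => a b; rewrite !mxE; case: splitP => j aj.
  by rewrite -val_eqE/= aj [j]ord1 /= .
by rewrite !mxE -!val_eqE/= aj.
Qed.

Lemma row_ord0_col_mx {k m} (u : 'rV[R]_m) (V : 'M[R]_(k, m)) :
  row ord0 (col_mx u V : 'M[R]_(1 + k, m)) = u.
Proof. by rewrite -(setrow0_col_mx u u V) row_setrow. Qed.

Lemma row_lift_col_mx {k m} i (u : 'rV[R]_m) (V : 'M[R]_(k, m)) :
  row (lift ord0 i) (col_mx u V : 'M[R]_(1 + k, m)) = row i V.
Proof.
apply/rowP => b; rewrite !mxE; case: splitP => j aj.
  by have := ltn_ord j; rewrite -aj.
by congr (V _ _); apply/val_inj; move: aj => /= -[].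
Qed.

Lemma row'_lift_col_mx {k m} (i : 'I_k.+1) (u : 'rV[R]_m) (V : 'M[R]_(k.+1, m)) :
  row' (lift ord0 i) (col_mx u V : 'M[R]_(1 + k.+1, m)) =
  (col_mx u (row' i V) : 'M[R]_(1 + k, m)).
Proof.
apply/matrixP => a b; rewrite [LHS]mxE.
have [a'|] := unliftP ord0 a => [->|->].
  have -> : lift (lift ord0 i) (lift ord0 a') = lift ord0 (lift i a') :> 'I_k.+2.
    by apply/val_inj; rewrite /= /bump/= !add1n ltnS addnS.
  have := row_lift_col_mx (lift i a') u V => /rowP/(_ b).
  have := row_lift_col_mx a' u (row' i V) => /rowP/(_ b).
  by rewrite !mxE => -> ->.
have -> : lift (lift ord0 i) ord0 = ord0 :> 'I_k.+2 by apply/val_inj.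
have := row_ord0_col_mx u V => /rowP/(_ b).
have := row_ord0_col_mx u (row' i V) => /rowP/(_ b).
by rewrite !mxE => -> ->.
Qed.

Definition multilinear {k m} (w : 'M[R]_(k, m) -> C) :=
  forall i x y (b c : R) A,
    w (setrow i (b *: x + c *: y) A)
    = b%:C%C * w (setrow i x A) + c%:C%C * w (setrow i y A).

Definition alternate {k m} (w : 'M[R]_(k, m) -> C) :=
  forall A i j, i != j -> row i A = row j A -> w A = 0.

(** Trades the relational multilinearity, three matrices that agree off one row, for equations in
    [setrow] that can be rewritten with. *)
Lemma alternating_formE {k m} (w : 'M[R]_(k, m) -> C) :
  alternating_form w <-> multilinear w /\ alternate w.
Proof.
split=> [[ml al]|[ml al]]; split=> //.
- move=> i x y b c A; apply: (ml _ _ _ i); rewrite ?row_setrow ?row'_setrow //.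
- move=> A B D i b c eA eB eD.
  rewrite -{1}(setrow_id i A) eA ml; congr (_ * w _ + _ * w _); exact: setrow_row.
Qed.

Lemma multilinear0 {k m} (w : 'M[R]_(k, m) -> C) i A :
  multilinear w -> w (setrow i 0 A) = 0.
Proof.
by move=> ml; have := ml i 0 0 0 0 A; rewrite !scale0r addr0 !mul0r addr0.
Qed.

Lemma multilinearD {k m} (w : 'M[R]_(k, m) -> C) i x y A :
  multilinear w -> w (setrow i (x + y) A) = w (setrow i x A) + w (setrow i y A).
Proof. by move=> ml; have := ml i x y 1 1 A; rewrite !scale1r !mul1r. Qed.

Lemma multilinearZ {k m} (w : 'M[R]_(k, m) -> C) i b x A :
  multilinear w -> w (setrow i (b *: x) A) = b%:C%C * w (setrow i x A).
Proof.
by move=> ml; have := ml i x 0 b 0 A; rewrite scale0r addr0 mul0r addr0.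
Qed.

Lemma multilinearN {k m} (w : 'M[R]_(k, m) -> C) i x A :
  multilinear w -> w (setrow i (- x) A) = - w (setrow i x A).
Proof.
by move=> ml; rewrite -scaleN1r multilinearZ// rmorphN1 mulN1r.
Qed.

Lemma multilinear_sum {k m} (w : 'M[R]_(k, m) -> C) i A (I : Type) (r : seq I)
    (P : pred I) (x : I -> 'rV[R]_m) : multilinear w ->
  w (setrow i (\sum_(l <- r | P l) x l) A) = \sum_(l <- r | P l) w (setrow i (x l) A).
Proof.
move=> ml; elim/big_ind2: _ => [|x1 s1 x2 s2 h1 h2|//].
  exact: multilinear0.
by rewrite multilinearD// h1 h2.
Qed.

(** Induction on the number of arguments, expanding the first row in the standard basis. Any finite
    expansion will do, even with repeated indices: [multilinearE] recovers the coefficients from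
    it. *)
Lemma multilinear_expand {k m} (w : 'M[R]_(k, m) -> C) : multilinear w ->
  exists s : seq (C * {ffun 'I_k -> 'I_m}), forall B,
    w B = \sum_(p <- s) p.1 * (\prod_j B j (p.2 j))%:C%C.
Proof.
elim: k w => [|k IH] w ml.
  have h : 'I_0 -> 'I_m by case.
  exists [:: (w 0, finfun h)] => B; rewrite big_seq1/= big_ord0 mulr1.
  by congr w; apply/matrixP => -[].
pose wc c (B : 'M[R]_(k, m)) := w (col_mx (delta_mx 0 c : 'rV[R]_m) B).
have /choice[s hs] : forall c, exists s : seq (C * {ffun 'I_k -> 'I_m}), forall B,
    wc c B = \sum_(p <- s) p.1 * (\prod_j B j (p.2 j))%:C%C.
  move=> c; apply: IH => i x y b d A.
  by rewrite /wc -!setrow_lift_col_mx; exact: ml.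
pose ext (c : 'I_m) (p : C * {ffun 'I_k -> 'I_m}) : C * {ffun 'I_k.+1 -> 'I_m} :=
  (p.1, [ffun j => oapp p.2 c (unlift ord0 j)]).
exists (flatten [seq map (ext c) (s c) | c <- enum 'I_m]) => B.
rewrite big_flatten/= big_map big_enum/=.
rewrite -{1}(setrow_id ord0 B) {1}(row_sum_delta (row ord0 B)) multilinear_sum//.
apply: eq_bigr => c _; rewrite multilinearZ// big_map.
rewrite setrow0E -/(wc c _) hs big_distrr/=; apply: eq_bigr => p _.
rewrite mulrCA -rmorphM/= big_ord_recl ffunE unlift_none/= mxE.
congr (_ * (_ * _)%:C%C); apply: eq_bigr => j _.
by rewrite !mxE ffunE liftK.
Qed.

Definition basis_mx {k m} (f : {ffun 'I_k -> 'I_m}) : 'M[R]_(k, m) :=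
  \matrix_(j, c) (c == f j)%:R.

Lemma prod_basis_mx {k m} (f g : {ffun 'I_k -> 'I_m}) :
  \prod_j basis_mx f j (g j) = (f == g)%:R.
Proof.
case: eqP => [->|/eqP fg].
  by rewrite big1// => j _; rewrite mxE eqxx.
have [j fgj] : exists j, f j != g j.
  apply/existsP; apply: contraNT fg => /existsPn h; apply/eqP/ffunP => j.
  by have /negPn/eqP := h j.
by rewrite (bigD1 j)//= mxE eq_sym (negPf fgj) mul0r.
Qed.

(** Evaluating an arbitrary expansion at the basis matrices collects the terms with equal index map.
    The form becomes an explicit polynomial in the entries, which is what gets differentiated
    later. *)
Lemma multilinearE {k m} (w : 'M[R]_(k, m) -> C) : multilinear w ->
  forall B, w B = \sum_f w (basis_mx f) * (\prod_j B j (f j))%:C%C.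
Proof.
move=> /multilinear_expand[s hs] B; under eq_bigr do rewrite hs big_distrl/=.
rewrite exchange_big/= hs; apply: eq_bigr => p _.
rewrite (bigD1 p.2)//= prod_basis_mx eqxx mulr1 [X in _ + X]big1 ?addr0// => f fp.
by rewrite prod_basis_mx (negPf fp) mulr0 mul0r.
Qed.

(** Polarization: [w] vanishes with [x + y] in both slots. *)
Lemma alternate_swap {k m} (w : 'M[R]_(k, m) -> C) i j x y A :
  alternating_form w -> i != j ->
  w (setrow i x (setrow j y A)) = - w (setrow i y (setrow j x A)).
Proof.
move=> /alternating_formE[ml al] ij.
have z u v : row i (setrow i u (setrow j v A)) = u by rewrite row_setrow.
have z' u v : row j (setrow i u (setrow j v A)) = v.
  by rewrite row_setrow_neq 1?eq_sym// row_setrow.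
have zz u : w (setrow i u (setrow j u A)) = 0 by apply: (al _ i j); rewrite ?z ?z'.
have := zz (x + y); rewrite multilinearD// ![setrow i _ (setrow j (x + y) A)]setrowC//.
rewrite !multilinearD// ![setrow j _ (setrow i _ A)]setrowC 1?eq_sym//.
by rewrite !zz add0r addr0 => /eqP; rewrite addr_eq0 => /eqP.
Qed.

Lemma alternate_perm {k m} (w : 'M[R]_(k, m) -> C) (s : 'S_k) A :
  alternating_form w -> w (row_perm s A) = (-1) ^+ s * w A.
Proof.
move=> alt; have [ts -> dts] := prod_tpermP s.
elim: ts dts A => [|t ts IH] /=.
  move=> _ A; rewrite big_nil; have -> : row_perm 1%g A = A by exact: row_perm1.
  by rewrite odd_perm1 mul1r.
move=> /andP[dt dts] A; rewrite big_cons.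
rewrite row_permM odd_mul_tperm dt signr_addb -mulrA -IH//.
set B := row_perm _ A.
rewrite mulN1r.
have e (D : 'M[R]_(k, m)) : setrow t.1 (row t.1 D) (setrow t.2 (row t.2 D) D) = D.
  by rewrite !setrow_id.
rewrite -[in RHS](e B) -alternate_swap//; congr w.
apply/matrixP => a b; rewrite !mxE.
case: (eqVneq a t.1) => [->|a1]; first by rewrite tpermL .
case: (eqVneq a t.2) => [->|a2]; first by rewrite tpermR.
by rewrite tpermD// eq_sym.
Qed.

(** Average [w] over all row permutations with signs: for each index map [f] the monomials add up to
    the minor on the columns [f]. Letting [f] range over all maps, not only increasing ones, is paid
    for by the factor [k!]. *)
Lemma det_expand {k m} (w : 'M[R]_(k, m) -> C) : alternating_form w ->
  forall B, w B = \sum_f (w (basis_mx f) / k`!%:R) * (\det (colsub f B))%:C%C.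
Proof.
move=> alt B; have /alternating_formE[ml _] := alt.
have fk0 : k`!%:R != 0 :> C by rewrite pnatr_eq0 -lt0n fact_gt0.
apply: (mulfI fk0); rewrite mulr_natl.
have -> : w B *+ k`! = \sum_(s : 'S_k) (-1) ^+ s * w (row_perm s B).
  under eq_bigr do rewrite alternate_perm// mulrA -signr_addb addbb mul1r.
  by rewrite sumr_const card_Sn.
under eq_bigr do rewrite multilinearE// big_distrr/=.
rewrite exchange_big/= big_distrr/=; apply: eq_bigr => f _.
rewrite [RHS]mulrA [_%:R * _]mulrC divfK// -det_tr.
rewrite /determinant rmorph_sum/= big_distrr/=.
apply: eq_bigr => s _; rewrite mulrCA; congr (_ * _).
rewrite rmorphM rmorphXn rmorphN1; congr (_ * (_)%:C%C).
by apply: eq_bigr => j _; rewrite !mxE.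
Qed.

Lemma det_alternating {k m} (I : finType) (a : I -> C) (f : I -> 'I_k -> 'I_m) :
  alternating_form (fun B : 'M[R]_(k, m) => \sum_l a l * (\det (colsub (f l) B))%:C%C).
Proof.
split=> [A B D i b c eA eB eD|A i j ij e].
  rewrite !mulr_sumr -big_split/=; apply: eq_bigr => l _.
  rewrite (determinant_multilinear (A := colsub (f l) A) (B := colsub (f l) B)
     (C := colsub (f l) D) (i0 := i) (b := b) (c := c)).
  - by rewrite rmorphD !rmorphM/= mulrDr [b%:C%C * (_ * _)]mulrCA [c%:C%C * (_ * _)]mulrCA.
  - by apply/rowP => j; have /rowP/(_ (f l j)) := eA; rewrite !mxE.
  - by apply/matrixP => p q; have /matrixP/(_ p (f l q)) := eB; rewrite !mxE.
  - by apply/matrixP => p q; have /matrixP/(_ p (f l q)) := eD; rewrite !mxE.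
apply: big1 => l _; rewrite (determinant_alternate (i1 := i) (i2 := j)) ?mulr0//.
by move=> p; have /rowP/(_ (f l p)) := e; rewrite !mxE.
Qed.

Lemma eq_alternating {k m} (w w' : 'M[R]_(k, m) -> C) :
  w =1 w' -> alternating_form w -> alternating_form w'.
Proof. by move=> /funext ->. Qed.

(** The exterior derivative at a point, when [h u] is the derivative of the form in direction
    [u]. *)
Definition antisymmetrize {k m} (h : 'rV[R]_m -> 'M[R]_(k, m) -> C)
    (A : 'M[R]_(k.+1, m)) : C :=
  \sum_(i < k.+1) (-1) ^+ i * h (row i A) (row' i A).

(** With [h] expanded in minors, the signed sum over [i] is the Laplace expansion, along the first
    column, of determinants of size [k + 1]. Alternation is then inherited from the determinant,
    without tracking signs of deleted rows. *)
Lemma antisymmetrize_alternating {k m} (h : 'rV[R]_m -> 'M[R]_(k, m) -> C) :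
  (forall a b x y B, h (a *: x + b *: y) B = a%:C%C * h x B + b%:C%C * h y B) ->
  (forall x, alternating_form (h x)) -> alternating_form (antisymmetrize h).
Proof.
move=> hl ha.
have h0 B : h 0 B = 0.
  by have := hl 0 0 0 0 B; rewrite !scale0r addr0 !mul0r addr0.
have hsum (x : 'rV[R]_m) B : h x B = \sum_c (x 0 c)%:C%C * h (delta_mx 0 c) B.
  rewrite {1}(row_sum_delta x); apply: (big_ind2 (fun u v => h u B = v)) => //.
    move=> x1 s1 x2 s2 <- <-; have := hl 1 1 x1 x2 B.
    by rewrite !scale1r !mul1r.
  move=> c _; have := hl (x 0 c) 0 (delta_mx 0 c) 0 B.
  by rewrite scale0r addr0 mul0r addr0.
pose cf (p : 'I_m * {ffun 'I_k -> 'I_m}) := h (delta_mx 0 p.1) (basis_mx p.2) / k`!%:R.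
(* The column selected by the extra argument is put in front of the columns [p.2]. *)
pose g (p : 'I_m * {ffun 'I_k -> 'I_m}) (j : 'I_k.+1) := oapp p.2 p.1 (unlift ord0 j).
apply: (@eq_alternating _ _ (fun A => \sum_p cf p * (\det (colsub (g p) A))%:C%C));
  last exact: det_alternating.
move=> A; rewrite /antisymmetrize.
under [RHS]eq_bigr do rewrite hsum big_distrr/=.
under [RHS]eq_bigr do under eq_bigr do rewrite (det_expand _ (ha _)) !big_distrr/=.
under [RHS]eq_bigr do rewrite pair_big/=.
rewrite exchange_big/=; apply: eq_bigr => -[c f] _.
rewrite (expand_det_col _ ord0) rmorph_sum big_distrr/=; apply: eq_bigr => i _.
rewrite !mxE /g/= unlift_none/= /cf/=.
rewrite /cofactor addn0 !rmorphM rmorphXn rmorphN1/= !mulrA.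
set D1 := \det _; set D2 := \det _.
have -> : D1 = D2.
  by congr (\det _); apply/matrixP => a b; rewrite !mxE /g liftK.
by congr (_ * _); rewrite [LHS]mulrC !mulrA mulrAC; congr (_ * _); rewrite mulrAC.
Qed.

End Alternating.

(** * Forms of type (k,0) and the complex trace *)

Section ComplexType.
Context {R : realType}.
Local Notation C := R[i].

Lemma alternating_setrow_row {k m} (w : 'M[R]_(k, m) -> C) i j A :
  alternating_form w -> i != j -> w (setrow i (row j A) A) = 0.
Proof.
move=> /alternating_formE[_ al] ij; apply: (al _ i j) => //.
by rewrite row_setrow row_setrow_neq// eq_sym.
Qed.

(** Moving [x] from the front to slot [i] passes [i] arguments. On each minor this compares two
    Laplace expansions along the row that holds [x]. *)
Lemma alternating_col_mx {k m} (w : 'M[R]_(k.+1, m) -> C) i (x : 'rV[R]_m)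
    (V : 'M[R]_(k.+1, m)) : alternating_form w ->
  w (col_mx x (row' i V) : 'M[R]_(1 + k, m)) = (-1) ^+ i * w (setrow i x V).
Proof.
move=> alt; rewrite !(det_expand _ alt) big_distrr/=; apply: eq_bigr => f _.
rewrite [RHS]mulrCA; congr (_ * _).
rewrite (expand_det_row _ ord0) [in RHS](expand_det_row _ i) !rmorph_sum big_distrr/=.
apply: eq_bigr => c _; rewrite /cofactor !rmorphM !rmorphXn rmorphN1/= [RHS]mulrCA.
rewrite [(-1) ^+ i * _]mulrA -exprD addnA -[in RHS]signr_odd oddD oddD addbb addFb.
rewrite signr_odd; congr (_ * (_ * _)).
  by congr (_%:C%C); rewrite !mxE eqxx; case: splitP => // j _; rewrite ord1.
congr ((\det _)%:C%C); apply/matrixP => a b; rewrite !mxE.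
rewrite [lift i a == i]eq_sym (negPf (neq_lift _ _)).
case: splitP => [j|j]/=.
  by move=> e; have := ltn_ord j; rewrite -e.
by rewrite /bump/= !add1n => -[e]; rewrite mxE; congr (V (lift i _) _); apply/val_inj.
Qed.

(** The action of [M] on forms as a derivation. *)
Definition derivation_form {k m} (w : 'M[R]_(k, m) -> C) (M : 'M[R]_m)
    (B : 'M[R]_(k, m)) : C :=
  \sum_(j < k) w (setrow j (row j B *m M) B).

Lemma derivation_form_alternating {k m} (w : 'M[R]_(k, m) -> C) M :
  alternating_form w -> alternating_form (derivation_form w M).
Proof.
move=> alt; have /alternating_formE[ml al] := alt.
apply/alternating_formE; split=> [i x y b c A|A i j ij e].
  rewrite /derivation_form !mulr_sumr -big_split/=; apply: eq_bigr => l _.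
  have [->|li] := eqVneq l i.
    by rewrite !row_setrow !setrowK mulmxDl -!scalemxAl ml.
  by rewrite !row_setrow_neq// !(setrowC l i)// ml.
(* Every term other than [i] and [j] still has two equal rows; these two cancel by a swap. *)
rewrite /derivation_form (bigD1 i)//= (bigD1 j) 1?eq_sym//= big1 ?addr0.
  have eA : A = setrow j (row j A) A by rewrite setrow_id.
  rewrite {1}e.
  have -> : setrow i (row j A *m M) A = setrow i (row j A *m M) (setrow j (row j A) A).
    by rewrite setrow_id.
  rewrite alternate_swap// [setrow i (row j A) _]setrowC// -e setrow_id.
  by rewrite addNr.
move=> l /andP[li lj]; apply: (al _ i j) => //.
by rewrite !row_setrow_neq// eq_sym.
Qed.

Definition type_form {k m} (J : 'M[R]_m) (w : 'M[R]_(k, m) -> C) :=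
  forall i x A, w (setrow i (x *m J) A) = ('i * w (setrow i x A))%C.

Lemma complex_splitE (a b : R) : (a +i* b)%C = a%:C%C + 'i * b%:C%C.
Proof.
rewrite -complexiE; apply/eqP; rewrite eq_complex/=.
by apply/andP; split; apply/eqP; ring.
Qed.

Lemma alternating_setrow_mul {k m} (w : 'M[R]_(k, m) -> C) i (u : 'rV[R]_k) A :
  alternating_form w -> w (setrow i (u *m A) A) = (u 0 i)%:C%C * w A.
Proof.
move=> alt; have /alternating_formE[ml _] := alt.
rewrite (mulmx_sum_row u A) multilinear_sum// (bigD1 i)//= big1 ?addr0.
  by rewrite multilinearZ// setrow_id.
by move=> l li; rewrite multilinearZ// alternating_setrow_row ?mulr0// eq_sym.
Qed.

(** The relation says that the rows of [A] are dependent over [C] with coefficients [a_j + i b_j].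
    Putting it into a slot [i] with nonzero coefficient leaves [(a_i + i b_i) w A = 0], as the other
    rows repeat an argument. *)
Lemma type_form_dependent {k m} (J : 'M[R]_m) (w : 'M[R]_(k, m) -> C)
    (a b : 'rV[R]_k) A : alternating_form w -> type_form J w ->
  (a != 0) || (b != 0) -> a *m A + b *m A *m J = 0 -> w A = 0.
Proof.
move=> alt ty ab0 rel; have /alternating_formE[ml _] := alt.
have [i abi] : exists i, (a 0 i != 0) || (b 0 i != 0).
  apply/existsP; apply: contraT; rewrite negb_exists => /forallP h.
  have {}h i : (a 0 i = 0) /\ (b 0 i = 0).
    by have := h i; rewrite negb_or !negbK => /andP[/eqP-> /eqP->].
  case/orP: ab0 => /eqP[]; apply/rowP => i; rewrite [RHS]mxE; [exact: (h i).1|exact: (h i).2].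
have := multilinear0 w i A ml.
rewrite -rel multilinearD// ty !alternating_setrow_mul// mulrA -mulrDl.
move/eqP; rewrite mulf_eq0 => /orP[|/eqP//]; rewrite -complex_splitE eq_complex/=.
by move=> /andP[/eqP h1 /eqP h2]; rewrite h1 h2 eqxx in abi.
Qed.

(** A complex linear [B] acts on a top-degree complex form by its complex trace, which is
    [(tr B - i tr (BJ)) / 2] in terms of real traces. This is the origin of the factor 1/2 in the
    theorem. *)
Lemma derivation_form_trace {n m} (J B : 'M[R]_m) (w : 'M[R]_(n, m) -> C)
    V : (m = n + n)%N -> J *m J = - 1%:M -> B *m J = J *m B ->
  alternating_form w -> type_form J w ->
  derivation_form w B V = (((\tr B)%:C - 'i * (\tr (B *m J))%:C) / 2)%C * w V.
Proof.
move=> mE; subst m => JJ BJ alt ty.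
have /alternating_formE[ml al] := alt.
have dty : type_form J (derivation_form w B).
  move=> i x A; rewrite /derivation_form mulr_sumr; apply: eq_bigr => l _.
  have [->|li] := eqVneq l i.
    by rewrite !row_setrow !setrowK -mulmxA -BJ mulmxA ty.
  by rewrite !row_setrow_neq// !(setrowC l i)// ty.
pose P := col_mx V (V *m J).
(* If the rows of [V] and [VJ] are not a real basis, then [V] is dependent over [C] and both sides
   vanish. *)
have [Pu|Pnu] := boolP (P \in unitmx); last first.
  have /rowV0Pn[u /sub_kermxP uP u0] : kermx P != 0 by rewrite kermx_eq0 row_free_unit.
  have u0' : (lsubmx u != 0) || (rsubmx u != 0).
    rewrite -negb_and; apply: contra u0 => /andP[/eqP h1 /eqP h2].
    by rewrite -(hsubmxK u) h1 h2 row_mx0.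
  have uV : lsubmx u *m V + rsubmx u *m V *m J = 0.
    by rewrite -mulmxA -mul_row_col hsubmxK.
  rewrite (type_form_dependent _ _ _ _ _ (derivation_form_alternating _ B alt) dty u0' uV).
  by rewrite (type_form_dependent _ _ _ _ _ alt ty u0' uV) mulr0.
(* In the basis [(V, VJ)], commutation with [J] forces the blocks [a, b, -b, a]: the real form of
   the complex matrix [a + ib]. *)
pose M := P *m B *m invmx P.
have MP : M *m P = P *m B by rewrite /M mulmxKV.
have trM X : \tr (P *m X *m invmx P) = \tr X.
  by rewrite mxtrace_mulC mulmxA mulVmx// mul1mx.
pose a := ulsubmx M; pose b := ursubmx M.
have := MP; rewrite -{1}(submxK M) -/a -/b mul_block_col mul_col_mx => /eq_col_mx[VB].
have -> : V *m J *m B = a *m (V *m J) - b *m V.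
  rewrite -mulmxA -BJ mulmxA -VB mulmxDl -!mulmxA JJ mulmxN.
  by rewrite mulmxA mulmxN mulmx1.
move=> E.
have [dl dr] : dlsubmx M = - b /\ drsubmx M = a.
  have : row_mx (dlsubmx M + b) (drsubmx M - a) *m P = 0.
    rewrite mul_row_col mulmxBl mulmxDl addrACA E.
    by rewrite addrA subrK subrr.
  move=> /(congr1 (mulmx^~ (invmx P))); rewrite mulmxK// mul0mx.
  rewrite -[RHS](@row_mx0 _ _ n n) => /eq_row_mx[/eqP e1 /eqP e2].
  by move: e1 e2; rewrite addr_eq0 subr_eq0 => /eqP-> /eqP->.
have ME : M = block_mx a b (- b) a by rewrite -{1}(submxK M) dl dr.
have -> : \tr B = \tr a + \tr a by rewrite -trM -/M ME mxtrace_block.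
have -> : \tr (B *m J) = - (\tr b + \tr b).
  rewrite -trM mulmxA.
  have -> : P *m B *m J *m invmx P = M *m (P *m J *m invmx P).
    by rewrite !mulmxA MP.
  have -> : P *m J *m invmx P = block_mx 0 1%:M (- 1%:M) 0.
    rewrite -[RHS](mulmxK Pu); congr (_ *m _).
    rewrite mul_block_col !mul0mx mul1mx add0r addr0 mulNmx mul1mx.
    by rewrite mul_col_mx -mulmxA JJ mulmxN mulmx1.
  rewrite ME mulmx_block !mulmx0 !mulmxN !mulmx1 !add0r !addr0 mxtrace_block.
  by rewrite !raddfN -opprD.
rewrite /derivation_form.
have -> : \sum_(j < n) w (setrow j (row j V *m B) V) =
    \sum_(j < n) ((a j j)%:C%C + 'i * (b j j)%:C%C) * w V.
  apply: eq_bigr => j _; rewrite -row_mul -VB linearD/= !row_mul mulmxA.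
  rewrite multilinearD// ty !alternating_setrow_mul// !mxE.
  by rewrite mulrDl mulrA.
rewrite -mulr_suml; congr (_ * _); rewrite big_split/= -mulr_sumr.
rewrite -!rmorph_sum/= -!/(\tr _).
have -> : ('i : C) * (\tr b)%:C%C = ((2 * 'i * (\tr b)%:C) / 2)%C.
  by rewrite mulrAC [2 * 'i]mulrC mulfK ?pnatr_eq0.
have -> : (\tr a)%:C%C = ((2 * (\tr a)%:C) / 2)%C :> C.
  by rewrite mulrAC mulfV ?mul1r ?pnatr_eq0.
rewrite -mulrDl; congr (_ / _).
by rewrite rmorphN !rmorphD/=; ring.
Qed.

End ComplexType.

(** * The vanishing of the differential as linear algebra *)

Section ClosedAlgebra.
Context {R : realType}.
Local Notation C := R[i].

(** [h u] is the derivative of the twisted form in direction [u], with the scalar factor divided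
    out: [N] gives the derivative of sigma, [lam] the logarithmic derivative of the factor. The
    other hypotheses are torsion-freeness, integrability and unimodularity. The antisymmetrization
    is shown to have type (k+2,0) in complex dimension k+1. *)
Lemma closed_invariant_form {k m} (w : 'M[R]_(k.+1, m) -> C) (J : 'M[R]_m)
    (N ad : 'rV[R]_m -> 'M[R]_m) (lam : 'rV[R]_m -> C) :
  (m = k.+1 + k.+1)%N -> J *m J = - 1%:M -> alternating_form w -> type_form J w ->
  (forall a b x y, N (a *: x + b *: y) = a *: N x + b *: N y) ->
  (forall u (v : 'rV[R]_m), v *m ad u = u *m N v - v *m N u) ->
  (forall u (v : 'rV[R]_m), v *m ad u + (v *m ad (u *m J) + v *m J *m ad u) *m J
               - v *m J *m ad (u *m J) = 0) ->
  (forall u, \tr (ad u) = 0) ->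
  (forall u, lam u = (- ('i / 2) * (\tr (ad u *m J))%:C)%C) ->
  forall A, antisymmetrize
    (fun u B => derivation_form w (N u) B + lam u * w B) A = 0.
Proof.
move=> mE JJ alt ty Nlin adE nij tr0 lamE A.
have /alternating_formE[ml _] := alt.
have adlin a b x y : ad (a *: x + b *: y) = a *: ad x + b *: ad y.
  apply/row_matrixP => i; rewrite linearD !linearZ /= !rowE !adE Nlin mulmxDl.
  rewrite -!scalemxAl mulmxDr -!scalemxAr.
  by rewrite !scalerBr opprD addrACA.
have lamlin a b x y : lam (a *: x + b *: y) = a%:C%C * lam x + b%:C%C * lam y.
  rewrite !lamE adlin mulmxDl -!scalemxAl linearD !linearZ/= rmorphD !rmorphM/=.
  by rewrite mulrDr !(mulrCA (- _)).
set h := fun u B => _.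
have hlin a b x y B : h (a *: x + b *: y) B = a%:C%C * h x B + b%:C%C * h y B.
  rewrite /h lamlin mulrDl !mulrDr addrACA !mulrA; congr (_ + _).
  rewrite /derivation_form !mulr_sumr -big_split/=; apply: eq_bigr => j _.
  by rewrite Nlin mulmxDr -!scalemxAr ml.
have halt u : alternating_form (h u).
  have [a1 a2] := derivation_form_alternating w (N u) alt; have [b1 b2] := alt.
  split=> [A' B D i b c eA eB eD|A' i j ij e].
    by rewrite /h (a1 _ _ _ _ _ _ eA eB eD) (b1 _ _ _ _ _ _ eA eB eD); ring.
  by rewrite /h (a2 _ _ _ ij e) (b2 _ _ _ ij e) mulr0 addr0.
pose Om := antisymmetrize h.
have Oalt : alternating_form Om by exact: antisymmetrize_alternating.
have w0J x (V : 'M[R]_(k, m)) : w (col_mx (x *m J) V : 'M[R]_(1 + k, m)) =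
    'i * w (col_mx x V : 'M[R]_(1 + k, m)).
  by rewrite -(setrow0_col_mx _ x V) ty setrow0_col_mx.
(* Separates, in each term, the part where [N] acts on [u]; moving that argument back to slot [i]
   absorbs the sign, so that these parts can be compared with a [derivation_form]. *)
have OE u (V : 'M[R]_(k.+1, m)) : Om (col_mx u V : 'M[R]_(1 + k.+1, m)) =
   h u V - \sum_(i < k.+1) (w (setrow i (u *m N (row i V)) V) +
     (-1) ^+ i * (\sum_(j < k) w (col_mx u (setrow j (row j (row' i V) *m N (row i V)) (row' i V))
         : 'M[R]_(1 + k, m)) + lam (row i V) * w (col_mx u (row' i V) : 'M[R]_(1 + k, m)))).
  rewrite /Om /antisymmetrize big_ord_recl expr0 mul1r row_ord0_col_mx row'_ord0_col_mx.
  rewrite -sumrN; congr (_ + _); apply: eq_bigr => i _.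
  rewrite row_lift_col_mx row'_lift_col_mx lift0 exprS mulN1r mulNr; congr (- _).
  have -> : w (setrow i (u *m N (row i V)) V) =
      (-1) ^+ i * ((-1) ^+ i * w (setrow i (u *m N (row i V)) V)).
    by rewrite mulrA -expr2 sqrr_sign mul1r.
  rewrite -mulrDr; congr (_ * _); rewrite -alternating_col_mx// addrA /h; congr (_ + _).
  rewrite /derivation_form big_ord_recl row_ord0_col_mx setrow0_col_mx.
  congr (_ + _); apply: eq_bigr => j _.
  by rewrite setrow_lift_col_mx row_lift_col_mx.
(* [Om (Ju, V) - i Om (u, V)]: the terms having [u] as an argument of [w] cancel. *)
have O0 u V : Om (col_mx (u *m J) V : 'M[R]_(1 + k.+1, m)) =
    'i * Om (col_mx u V : 'M[R]_(1 + k.+1, m)).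
  apply/eqP; rewrite -subr_eq0; apply/eqP; rewrite !OE.
  (* [B] is [[Ju, .] - J [u, .]], that is, [-J] composed with the [B_u] of the overview. This
     version appears directly when [i] times the value at [u] is subtracted from the value at
     [Ju]. *)
  pose B := ad (u *m J) - ad u *m J.
  have BJ : B *m J = J *m B.
    apply/row_matrixP => i; rewrite !rowE !mulmxA.
    rewrite /B !mulmxBr mulmxBl !mulmxA -[_ *m J *m J]mulmxA JJ mulmxN mulmx1 opprK.
    apply/eqP; rewrite -subr_eq0; apply/eqP; rewrite -[RHS](nij u (delta_mx 0 i)).
    by rewrite mulmxDl opprB !addrA; congr (_ + _ - _); exact: addrC.
  have trB : \tr B = - \tr (ad u *m J) by rewrite /B raddfB/= tr0 sub0r.
  have trBJ : \tr (B *m J) = \tr (ad (u *m J) *m J).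
    by rewrite /B mulmxBl -mulmxA JJ mulmxN mulmx1 opprK raddfD/= tr0 addr0.
  have := derivation_form_trace J B w V mE JJ BJ alt ty; rewrite trB trBJ.
  (* Torsion-freeness splits [B] into derivatives along the rows of [V], found in the sums of [OE],
     and derivatives along [u] and [Ju], found in [h]. *)
  have -> : derivation_form w B V =
      \sum_(i < k.+1) (w (setrow i (u *m J *m N (row i V)) V)
                       - 'i * w (setrow i (u *m N (row i V)) V))
      - (derivation_form w (N (u *m J)) V - 'i * derivation_form w (N u) V).
    rewrite /derivation_form mulr_sumr -!sumrB; apply: eq_bigr => i _.
    rewrite /B mulmxBr mulmxA !adE mulmxBl opprB.
    rewrite !multilinearD// !multilinearN// multilinearD// multilinearN// !ty.
    by ring.
  set S := \sum_(i < k.+1) _ => SE.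
  set S1 := \sum_(i < k.+1) _; set S2 := \sum_(i < k.+1) _.
  have -> : S1 = 'i * S2 + S.
    rewrite /S1 /S2 /S mulr_sumr -big_split/=; apply: eq_bigr => i _.
    under eq_bigr do rewrite w0J.
    by rewrite -mulr_sumr w0J; ring.
  move/eqP: SE; rewrite subr_eq => /eqP ->; rewrite /h !lamE.
  have i2 : 'i * 'i = -1 :> C by rewrite -expr2 sqrCi.
  rewrite rmorphN/=; move: (2^-1 : C) => c.
  ring: i2.
(* Alternation carries the rule from the first argument to the others. *)
have OJ : type_form J Om.
  move=> i x A'; have [->|i0] := eqVneq i ord0.
    by rewrite !setrow0E O0.
  have sw y : Om (setrow i y A') = - Om (setrow ord0 y (setrow i (row ord0 A') A')).
    rewrite -{1}(setrow_id ord0 A') alternate_swap// setrowC//.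
  by rewrite !sw setrow0E O0 -setrow0E mulrN.
(* [P] has [2(k+2)] rows but only [2(k+1)] columns, so its rows satisfy a nontrivial relation: the
   arguments are dependent over [C]. *)
pose P := col_mx A (A *m J).
have /rowV0Pn[u /sub_kermxP uP u0] : kermx P != 0.
  rewrite kermx_eq0 -row_leq_rank -ltnNge (leq_ltn_trans (rank_leq_col P))// mE.
  by rewrite !addSn !addnS ltnS leqnSn.
apply: (type_form_dependent J Om (lsubmx u) (rsubmx u)) => //.
  rewrite -negb_and; apply: contra u0 => /andP[/eqP h1 /eqP h2].
  by rewrite -(hsubmxK u) h1 h2 row_mx0.
by rewrite -mulmxA -mul_row_col hsubmxK.
Qed.
End ClosedAlgebra.

(** * Directional derivatives *)

Section Calculus.
Context {R : realType}.

Lemma near_eq_differentiable (V W : normedModType R) (f g : V -> W) x :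
  (\near x, f x = g x) -> differentiable f x -> differentiable g x.
Proof.
move=> fg df; have e := diff_locally df.
have dc : continuous ('d f x) by exact: diff_continuous.
have e' : g \o shift x = cst (g x) + 'd f x +o_ 0 id.
  apply/eqaddoP => eps eps0; have /eqaddoP/(_ _ eps0) := e.
  apply: filter_app; rewrite -(nbhs_singleton fg).
  have : \forall y \near 0, f (y + x) = g (y + x).
    by rewrite (near_shift 0) in fg; move: fg => /=; rewrite subr0.
  by apply: filter_app; near=> y => fgy; rewrite !fctE/= fgy.
apply/diff_locallyP; rewrite (diff_unique dc e'); split => //.
Unshelve. all: by end_near. Qed.

Lemma near_eq_continuous (V W : topologicalType) (f g : V -> W) x :
  (\near x, f x = g x) -> {for x, continuous f} -> {for x, continuous g}.
Proof.
move=> fg fc; rewrite /prop_for /continuous_at -(nbhs_singleton fg).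
exact: cvg_trans (near_eq_cvg fg) fc.
Qed.

Lemma derive_compE (U V W : normedModType R) (f : U -> V) (g : V -> W) x v :
  differentiable f x -> differentiable g (f x) ->
  'D_v (g \o f) x = 'D_('D_v f x) g (f x).
Proof.
move=> df dg; rewrite !deriveE//; last exact: differentiable_comp.
by rewrite diff_comp.
Qed.

Section Ck_lemmas.
Context {V : normedModType R}.

Lemma Ck_eq (W : normedModType R) k U (f g : V -> W) :
  open U -> {in U, f =1 g} -> Ck k U f -> Ck k U g.
Proof.
move=> oU; have near_fg (f' g' : V -> W) x : {in U, f' =1 g'} -> U x -> \near x, f' x = g' x.
  by move=> fg Ux; apply: filterS (open_nbhs_nbhs (conj oU Ux)) => y Uy; apply: fg; rewrite inE.
elim: k f g => [|k IH] f g fg /=.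
  by move=> fc x Ux; apply: near_eq_continuous (fc x Ux); exact: near_fg.
move=> [fd fD]; split=> [x Ux|v].
  by apply: near_eq_differentiable (fd x Ux); exact: near_fg.
apply: IH (fD v) => x; rewrite inE => Ux.
by apply: near_eq_derive; exact: near_fg.
Qed.

Lemma Ck_sub (W : normedModType R) k (U U' : set V) (f : V -> W) :
  U' `<=` U -> Ck k U f -> Ck k U' f.
Proof.
move=> UU; elim: k f => [|k IH] f /=; first by move=> fc x /UU; exact: fc.
by move=> [fd fD]; split=> [x /UU|v]; [exact: fd|exact: IH].
Qed.

Lemma Ck_leS (W : normedModType R) k (U : set V) (f : V -> W) :
  Ck k.+1 U f -> Ck k U f.
Proof.
elim: k f => [|k IH] f [fd fD]; first by move=> x Ux; exact/differentiable_continuous/fd.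
by split=> // v; apply: IH; exact: fD.
Qed.

Lemma Ck_cst (W : normedModType R) k (U : set V) (a : W) : Ck k U (fun=> a).
Proof.
elim: k a => [|k IH] a /=; first by move=> x _; exact: cst_continuous.
split=> [x _|v]; first exact: differentiable_cst.
have -> : (fun x : V => 'D_v (fun=> a) x) = fun=> 0 by apply/funext => x; rewrite derive_cst.
exact: IH.
Qed.

Lemma CkD (W : normedModType R) k (U : set V) (f g : V -> W) : open U ->
  Ck k U f -> Ck k U g -> Ck k U (fun x => f x + g x).
Proof.
move=> oU; elim: k f g => [|k IH] f g /=.
  by move=> fc gc x Ux; apply: continuousD; [exact: fc|exact: gc].
move=> [fd fD] [gd gD]; split=> [x Ux|v].
  by apply: differentiableD; [exact: fd|exact: gd].
apply: Ck_eq (IH _ _ (fD v) (gD v)) => // x; rewrite inE => Ux.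
by rewrite deriveD//; apply: diff_derivable; [exact: fd|exact: gd].
Qed.

Lemma CkM k (U : set V) (f g : V -> R^o) : open U ->
  Ck k U f -> Ck k U g -> Ck k U (fun x => f x * g x : R^o).
Proof.
move=> oU; elim: k f g => [|k IH] f g.
  by move=> fc gc x Ux; apply: continuousM; [exact: fc|exact: gc].
move=> fC gC; have [fd fD] := fC; have [gd gD] := gC; split=> [x Ux|v].
  by apply: differentiableM; [exact: fd|exact: gd].
have := CkD _ _ _ _ _ oU (IH _ _ (Ck_leS _ _ _ _ fC) (gD v)) (IH _ _ (Ck_leS _ _ _ _ gC) (fD v)).
apply: Ck_eq => // x; rewrite inE => Ux.
by rewrite deriveM//; apply: diff_derivable; [exact: fd|exact: gd].
Qed.

Lemma differentiable_cos (x : R) : differentiable (cos : R^o -> R^o) x.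
Proof. exact/derivable1_diffP/derivable_cos. Qed.

Lemma differentiable_sin (x : R) : differentiable (sin : R^o -> R^o) x.
Proof. exact/derivable1_diffP/derivable_sin. Qed.

Lemma derive_cos_comp (f : V -> R^o) x v : differentiable f x ->
  'D_v (fun y => cos (f y) : R^o) x = - sin (f x) * 'D_v f x.
Proof.
move=> fd; have := derive_compE _ _ _ _ (cos : R^o -> R^o) x v fd (differentiable_cos _).
rewrite /comp => ->; rewrite deriveE; last exact: differentiable_cos.
rewrite -[X in 'd _ _ X]mulr1 -[X in 'd _ _ X]/(_ *: _) linearZ/=.
rewrite -deriveE; last exact: differentiable_cos.
by rewrite derive_val mulrC.
Qed.

Lemma derive_sin_comp (f : V -> R^o) x v : differentiable f x ->
  'D_v (fun y => sin (f y) : R^o) x = cos (f x) * 'D_v f x.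
Proof.
move=> fd; have := derive_compE _ _ _ _ (sin : R^o -> R^o) x v fd (differentiable_sin _).
rewrite /comp => ->; rewrite deriveE; last exact: differentiable_sin.
rewrite -[X in 'd _ _ X]mulr1 -[X in 'd _ _ X]/(_ *: _) linearZ/=.
rewrite -deriveE; last exact: differentiable_sin.
by rewrite derive_val mulrC.
Qed.

Lemma Ck_cos_sin k (U : set V) (f : V -> R^o) : open U -> Ck k U f ->
  Ck k U (fun x => cos (f x) : R^o) /\ Ck k U (fun x => sin (f x) : R^o).
Proof.
move=> oU; elim: k f => [|k IH] f.
  move=> fc; split=> x Ux; apply: continuous_comp; [exact: fc| |exact: fc|].
    exact: continuous_cos.
  exact: continuous_sin.
move=> fC; have [fd fD] := fC; have [Cc Cs] := IH _ (Ck_leS _ _ _ _ fC).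
split; split=> [x Ux|v].
- exact/(differentiable_comp (fd x Ux))/differentiable_cos.
- have := CkM _ _ _ _ oU (CkM _ _ _ _ oU (Ck_cst _ k U (-1 : R^o)) Cs) (fD v).
  apply: Ck_eq => // x; rewrite inE => Ux.
  by rewrite derive_cos_comp ?mulN1r//; exact: fd.
- exact/(differentiable_comp (fd x Ux))/differentiable_sin.
- have := CkM _ _ _ _ oU Cc (fD v).
  apply: Ck_eq => // x; rewrite inE => Ux.
  by rewrite derive_sin_comp//; exact: fd.
Qed.

End Ck_lemmas.

Lemma differentiable_pair_cst (V W : normedModType R) (b : W) (x : V) :
  differentiable (fun y : V => (y, b)) x.
Proof. exact: differentiable_pair. Qed.

Lemma derive_pair_cst (V W : normedModType R) (b : W) (x v : V) :
  'D_v (fun y : V => (y, b)) x = (v, 0).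
Proof.
rewrite deriveE; last exact: differentiable_pair_cst.
by rewrite diff_pair//= diff_cst; have [_ ->] := is_diff_id x.
Qed.

Lemma open_slice (V W : topologicalType) (U : set (V * W)) b :
  open U -> open [set x | U (x, b)].
Proof.
move=> oU; have c : continuous (fun x : V => (x, b)).
  by move=> x; apply: cvg_pair; [exact: cvg_id|exact: cvg_cst].
by have /continuousP/(_ _ oU) := c.
Qed.

Lemma open_slice_r (V W : topologicalType) (U : set (V * W)) a :
  open U -> open [set y | U (a, y)].
Proof.
move=> oU; have c : continuous (fun y : W => (a, y)).
  by move=> x; apply: cvg_pair; [exact: cvg_cst|exact: cvg_id].
by have /continuousP/(_ _ oU) := c.
Qed.

Lemma Ck_slice (V W X : normedModType R) k (U : set (V * W)) (f : V * W -> X) (b : W) :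
  open U -> Ck k U f -> Ck k [set x | U (x, b)] (fun x => f (x, b)).
Proof.
move=> oU; elim: k f => [|k IH] f.
  move=> fc x Ux; apply: (@continuous_comp _ _ _ (fun x => (x, b)) f); last exact: fc.
  by apply: cvg_pair; [exact: cvg_id|exact: cvg_cst].
move=> [fd fD]; split=> [x Ux|v].
  exact: (differentiable_comp (differentiable_pair_cst V W b x) (fd _ Ux)).
have := IH _ (fD (v, 0)); apply: Ck_eq; first exact: open_slice.
move=> x; rewrite inE/= => Ux.
have := derive_compE _ _ _ _ f x v (differentiable_pair_cst V W b x) (fd _ Ux).
by rewrite derive_pair_cst => <-.
Qed.

Lemma derive_pair_cst_r (V W : normedModType R) (a : V) (x v : W) :
  'D_v (fun y : W => (a, y)) x = (0, v).
Proof.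
rewrite deriveE; last exact: differentiable_pair.
by rewrite diff_pair//= diff_cst; have [_ ->] := is_diff_id x.
Qed.

Lemma Ck_slice_r (V W X : normedModType R) k (U : set (V * W)) (f : V * W -> X) (a : V) :
  open U -> Ck k U f -> Ck k [set y | U (a, y)] (fun y => f (a, y)).
Proof.
move=> oU; elim: k f => [|k IH] f.
  move=> fc x Ux; apply: (@continuous_comp _ _ _ (fun y => (a, y)) f); last exact: fc.
  by apply: cvg_pair; [exact: cvg_cst|exact: cvg_id].
move=> [fd fD]; have pd y : differentiable (fun y : W => (a, y)) y by exact: differentiable_pair.
split=> [x Ux|v]; first exact: (differentiable_comp (pd x) (fd _ Ux)).
have := IH _ (fD (0, v)); apply: Ck_eq; first exact: open_slice_r.
move=> x; rewrite inE/= => Ux.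
have := derive_compE _ _ _ _ f x v (pd x) (fd _ Ux).
by rewrite derive_pair_cst_r => <-.
Qed.

Lemma is_derive_line (V : normedModType R) (f : V -> R^o) (y u : V) (s : R) :
  derivable f (y + s *: u) u ->
  is_derive (s : R^o) 1 (fun r : R^o => f (y + r *: u)) ('D_u f (y + s *: u)).
Proof.
have e : (fun h : R => h^-1 *: (((fun r : R^o => f (y + r *: u)) \o shift (s : R^o)) (h *: 1) -
            f (y + s *: u))) =
         (fun h => h^-1 *: ((f \o shift (y + s *: u)) (h *: u) - f (y + s *: u))).
  by apply/funext => h /=; rewrite /shift/= scalerDl [h *: 1]mulr1 addrCA.
by move=> df; apply: DeriveDef; rewrite /derivable /derive e.
Qed.

(** The mean value theorem in direction [u] for the increment of [f] under [h v], then in direction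
    [v] for ['D_u f]. *)
Lemma mixed_difference (V : normedModType R) (f : V -> R^o) (U : set V) x u v (h : R) :
  0 < h -> (forall s r, 0 <= s <= h -> 0 <= r <= h -> U (x + s *: u + r *: v)) ->
  (forall y, U y -> differentiable f y) ->
  (forall y, U y -> differentiable (fun z => 'D_u f z : R^o) y) ->
  exists s r, [/\ 0 <= s <= h, 0 <= r <= h &
    f (x + h *: u + h *: v) - f (x + h *: u) - (f (x + h *: v) - f x) =
    h ^+ 2 * 'D_v (fun z => 'D_u f z : R^o) (x + s *: u + r *: v)].
Proof.
move=> h0 hU fd fDd.
have hh : 0 <= h <= h by rewrite lexx ltW.
have h00 : 0 <= (0 : R) <= h by rewrite lexx ltW.
pose phi (s : R^o) : R^o := f (x + h *: v + s *: u) - f (x + s *: u).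
have U1 s : 0 <= s <= h -> U (x + h *: v + s *: u) /\ U (x + s *: u).
  move=> sh; split; first by rewrite addrAC; exact: hU.
  by have := hU s 0 sh h00; rewrite scale0r addr0.
have phid s : 0 <= s <= h ->
    is_derive s 1 phi ('D_u f (x + h *: v + s *: u) - 'D_u f (x + s *: u)).
  move=> /U1[Ua Ub]; apply: is_deriveB; apply: is_derive_line;
    by apply/diff_derivable/fd.
have [|//|s sh phiE] := @MVT R phi
    (fun s => 'D_u f (x + h *: v + s *: u) - 'D_u f (x + s *: u)) 0 h h0.
  by move=> s; rewrite in_itv/= => /andP[s0 s1]; apply: phid; rewrite !ltW.
  apply: derivable_within_continuous => s; rewrite in_itv/= => sh.
  by have [] := phid s sh.
have {}sh : 0 <= s <= h by move: sh; rewrite in_itv/= => /andP[s0 s1]; rewrite !ltW.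
pose psi (r : R^o) : R^o := 'D_u f (x + s *: u + r *: v).
have psid r : 0 <= r <= h ->
    is_derive r 1 psi ('D_v (fun z => 'D_u f z : R^o) (x + s *: u + r *: v)).
  move=> rh; apply: is_derive_line.
  by apply/diff_derivable/fDd/hU.
have [|//|r rh psiE] := @MVT R psi
    (fun r => 'D_v (fun z => 'D_u f z : R^o) (x + s *: u + r *: v)) 0 h h0.
  by move=> r; rewrite in_itv/= => /andP[r0 r1]; apply: psid; rewrite !ltW.
  apply: derivable_within_continuous => r; rewrite in_itv/= => rh.
  by have [] := psid r rh.
exists s, r; split => //.
  by move: rh; rewrite in_itv/= => /andP[r0 r1]; rewrite !ltW.
move: phiE psiE; rewrite /phi /psi !scale0r !addr0 !subr0.
rewrite [x + h *: v + s *: u]addrAC [x + h *: v + h *: u]addrAC => -> ->.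
by rewrite expr2 [RHS]mulrC mulrA.
Qed.

Lemma dist_le_half (e a b c : R) :
  `|a - c| < e / 2 -> `|b - c| < e / 2 -> `|a - b| <= e.
Proof.
move=> ac bc; have -> : a - b = (a - c) - (b - c) by rewrite opprB addrA subrK.
by apply: (le_trans (ler_normB _ _)); rewrite (splitr e) lerD// ltW.
Qed.

(* Both mixed derivatives are evaluated, by the mean value theorem, on the same
   second difference. *)
Lemma derive_symmetric (V : normedModType R) (f : V -> R^o) (U : set V) x u v :
  open U -> U x -> Ck 2 U f ->
  'D_v (fun z => 'D_u f z : R^o) x = 'D_u (fun z => 'D_v f z : R^o) x.
Proof.
move=> oU Ux [fd fD]; have [fDu fDDu] := fD u; have [fDv fDDv] := fD v.
set a := LHS; set b := RHS.
apply/eqP; rewrite -subr_eq0 -normr_le0; apply/ler_addgt0Pr => e e0; rewrite add0r.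
have e20 : 0 < e / 2 by rewrite divr_gt0.
pose A y := [/\ U y, `|a - 'D_v (fun z => 'D_u f z : R^o) y| < e / 2 &
                     `|b - 'D_u (fun z => 'D_v f z : R^o) y| < e / 2].
have nA : nbhs x A.
  have n1 : nbhs x U by exact: open_nbhs_nbhs.
  have n2 : \forall y \near x, `|a - 'D_v (fun z => 'D_u f z : R^o) y| < e / 2.
    by have /cvgrPdist_lt := fDDu v x Ux; apply.
  have n3 : \forall y \near x, `|b - 'D_u (fun z => 'D_v f z : R^o) y| < e / 2.
    by have /cvgrPdist_lt := fDDv u x Ux; apply.
  by apply: filterS3 n1 n2 n3.
have /nbhs_ballP[d /= d0 dA] := nA.
(* The [+ 1] keeps [M] positive when [u = v = 0]; with [h = d / 2 / M] the whole parallelogram lies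
   in the ball of radius [d]. *)
pose M := `|u| + `|v| + 1.
have M0 : 0 < M by rewrite ltr_wpDl// addr_ge0.
pose h := d / 2 / M.
have h0 : 0 < h by rewrite !divr_gt0.
have hA s r : 0 <= s <= h -> 0 <= r <= h -> A (x + s *: u + r *: v).
  move=> /andP[s0 sh] /andP[r0 rh]; apply: dA.
  rewrite -ball_normE/= -addrA opprD addrA subrr sub0r normrN.
  rewrite (le_lt_trans (ler_normD _ _))// !normrZ !ger0_norm//.
  rewrite (@le_lt_trans _ _ (h * M))//; last first.
    by rewrite divfK ?gt_eqF// ltr_pdivrMr// ltr_pMr// ltr1n.
  rewrite /M !mulrDr -addrA lerD ?ler_wpM2r// ler_wpDr ?ler_wpM2r// mulr1 ltW//.
have hA' s r : 0 <= s <= h -> 0 <= r <= h -> A (x + s *: v + r *: u).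
  by move=> hs hr; rewrite addrAC; exact: hA.
have [s [r [sh rh E1]]] := mixed_difference V f A x u v h h0 hA
  (fun y Ay => let: And3 Uy _ _ := Ay in fd y Uy) (fun y Ay => let: And3 Uy _ _ := Ay in fDu y Uy).
have [s' [r' [sh' rh' E2]]] := mixed_difference V f A x v u h h0 hA'
  (fun y Ay => let: And3 Uy _ _ := Ay in fd y Uy) (fun y Ay => let: And3 Uy _ _ := Ay in fDv y Uy).
have [_ a1 _] := hA _ _ sh rh; have [_ _ b1] := hA' _ _ sh' rh'.
have E : 'D_v (fun z => 'D_u f z : R^o) (x + s *: u + r *: v) =
         'D_u (fun z => 'D_v f z : R^o) (x + s' *: v + r' *: u).
  have h20 : h ^+ 2 != 0 by rewrite expf_neq0// gt_eqF.
  have swap (c1 c2 c3 c4 : R) : c1 - c2 - (c3 - c4) = c1 - c3 - (c2 - c4) by ring.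
  move: E1 E2; rewrite (addrAC x (h *: v) (h *: u)) swap => -> .
  exact: (mulfI h20).
by rewrite -E in b1; exact: dist_le_half a1 b1.
Qed.

End Calculus.

(** * Complex-valued functions and the product rule for varying forms *)

Section ComplexDerivative.
Context {R : realType} {V : normedModType R}.
Local Notation C := R[i].

(** [cderive] is defined even where the limits do not exist; this relation also records their
    existence, so that it can be propagated through sums and products. *)
Definition is_cderive (x v : V) (f : V -> C) (df : C) :=
  is_derive x v (fun y => complex.Re (f y) : R^o) (complex.Re df) /\
  is_derive x v (fun y => complex.Im (f y) : R^o) (complex.Im df).

Lemma is_cderiveE x v f df : is_cderive x v f df -> cderive f x v = df.
Proof. by move=> [h1 h2]; rewrite /cderive !derive_val; case: df {h1 h2}. Qed.

Lemma is_cderive_near x v f g df : (\near x, f x = g x) ->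
  is_cderive x v f df -> is_cderive x v g df.
Proof.
by move=> fg [h1 h2]; split; [apply: near_eq_is_derive h1|apply: near_eq_is_derive h2];
  apply: filterS fg => y ->.
Qed.

Lemma is_cderive_cst x v c : is_cderive x v (fun=> c) 0.
Proof. by split=> /=; exact: is_derive_cst. Qed.

Lemma is_cderiveD x v f g df dg : is_cderive x v f df -> is_cderive x v g dg ->
  is_cderive x v (fun y => f y + g y) (df + dg).
Proof.
move=> [f1 f2] [g1 g2]; split.
  have := is_deriveD f1 g1; rewrite !raddfD/=.
  by congr is_derive; apply/funext => y; rewrite raddfD.
have := is_deriveD f2 g2; rewrite !raddfD/=.
by congr is_derive; apply/funext => y; rewrite raddfD.
Qed.

Lemma is_cderive_sum x v (I : Type) (r : seq I) (P : pred I) (f : I -> V -> C) (df : I -> C) :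
  (forall i, is_cderive x v (f i) (df i)) ->
  is_cderive x v (fun y => \sum_(i <- r | P i) f i y) (\sum_(i <- r | P i) df i).
Proof.
move=> h; elim: r => [|i r IH].
  rewrite big_nil; have -> : (fun y : V => \sum_(i <- [::] | P i) f i y) = fun=> 0.
    by apply/funext => y; rewrite big_nil.
  exact: is_cderive_cst.
rewrite big_cons.
have -> : (fun y : V => \sum_(i <- i :: r | P i) f i y) =
  if P i then (fun y => f i y + \sum_(i <- r | P i) f i y)
  else (fun y => \sum_(i <- r | P i) f i y).
  by apply/funext => y; rewrite big_cons; case: (P i).
by case: (P i) => //; exact: is_cderiveD.
Qed.

Lemma is_derive_mulr (x v : V) (f g : V -> R^o) df dg : is_derive x v f df -> is_derive x v g dg ->
  is_derive x v (fun y => f y * g y : R^o) (df * g x + f x * dg).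
Proof.
move=> hf hg; have h := is_deriveM hf hg; apply: (is_derive_eq h).
by rewrite /GRing.scale/= addrC [df * _]mulrC.
Qed.

Lemma Re_add (a b : C) : complex.Re (a + b) = complex.Re a + complex.Re b.
Proof. by case: a b => ? ? []. Qed.

Lemma Im_add (a b : C) : complex.Im (a + b) = complex.Im a + complex.Im b.
Proof. by case: a b => ? ? []. Qed.

Lemma Re_mul (a b : C) :
  complex.Re (a * b) = complex.Re a * complex.Re b - complex.Im a * complex.Im b.
Proof. by case: a b => ? ? []. Qed.

Lemma Im_mul (a b : C) :
  complex.Im (a * b) = complex.Re a * complex.Im b + complex.Im a * complex.Re b.
Proof. by case: a b => ? ? []. Qed.

Lemma is_cderiveM x v f g df dg : is_cderive x v f df -> is_cderive x v g dg ->
  is_cderive x v (fun y => f y * g y) (df * g x + f x * dg).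
Proof.
move=> [f1 f2] [g1 g2]; split.
  have := is_deriveB (is_derive_mulr _ _ _ _ _ _ f1 g1) (is_derive_mulr _ _ _ _ _ _ f2 g2).
  have -> : (fun y => complex.Re (f y * g y)) =
      (fun y => complex.Re (f y) * complex.Re (g y) : R^o)
      - (fun y => complex.Im (f y) * complex.Im (g y) : R^o).
    by apply/funext => y; rewrite Re_mul.
  by move=> h; apply: (is_derive_eq h); rewrite Re_add !Re_mul; ring.
have := is_deriveD (is_derive_mulr _ _ _ _ _ _ f1 g2) (is_derive_mulr _ _ _ _ _ _ f2 g1).
have -> : (fun y => complex.Im (f y * g y)) =
    (fun y => complex.Re (f y) * complex.Im (g y) : R^o)
    + (fun y => complex.Im (f y) * complex.Re (g y) : R^o).
  by apply/funext => y; rewrite Im_mul.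
by move=> h; apply: (is_derive_eq h); rewrite Im_add !Im_mul; ring.
Qed.

Lemma is_cderive_real x v (f : V -> R^o) df : is_derive x v f df ->
  is_cderive x v (fun y => (f y)%:C%C) df%:C%C.
Proof. by move=> h; split => //=; exact: is_derive_cst. Qed.

(** The [j]-th factor is replaced inside the product, to match the entries of a [setrow]. *)
Lemma is_derive_prod (x v : V) n (f : 'I_n -> V -> R^o) (df : 'I_n -> R) :
  (forall i, is_derive x v (f i) (df i)) ->
  is_derive x v (fun y => \prod_i f i y : R^o)
    (\sum_j \prod_i (if i == j then df j else f i x)).
Proof.
elim: n f df => [|n IH] f df h.
  rewrite big_ord0; have -> : (fun y : V => \prod_i f i y : R^o) = fun=> 1.
    by apply/funext => y; rewrite big_ord0.
  exact: is_derive_cst.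
have -> : (fun y : V => \prod_i f i y : R^o) = fun y => f ord0 y * \prod_i f (lift ord0 i) y.
  by apply/funext => y; rewrite big_ord_recl.
have := is_derive_mulr _ _ _ _ _ _ (h ord0) (IH _ _ (fun i => h (lift ord0 i))).
move=> h'; apply: (is_derive_eq h'); rewrite big_ord_recl; congr (_ + _).
  by rewrite big_ord_recl eqxx; congr (_ * _); apply: eq_bigr.
rewrite big_distrr/=; apply: eq_bigr => j _; rewrite big_ord_recl (negPf (neq_lift _ _)).
by congr (_ * _); apply: eq_bigr.
Qed.

(** Form and arguments vary together. By [multilinearE] the value is a finite sum of coefficients
    times entries, and the scalar product rule applies to each term. *)
Lemma multilinear_product_rule k m (w : V -> 'M[R]_(k, m) -> C) (dw : 'M[R]_(k, m) -> C)
    (B : V -> 'M[R]_(k, m)) (dB : 'M[R]_(k, m)) x v :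
  (forall y, multilinear (w y)) ->
  (forall A, is_cderive x v (w^~ A) (dw A)) ->
  (forall i j, is_derive x v (fun y => B y i j : R^o) (dB i j)) ->
  is_cderive x v (fun y => w y (B y))
    (dw (B x) + \sum_j w x (setrow j (row j dB) (B x))).
Proof.
move=> ml hw hB.
have e : (fun y => w y (B y)) =
    fun y => \sum_f w y (basis_mx f) * (\prod_j B y j (f j))%:C%C.
  by apply/funext => y; rewrite multilinearE.
(* [dw] inherits the expansion of [w] by uniqueness of derivatives. *)
have dwE A : dw A = \sum_f dw (basis_mx f) * (\prod_j A j (f j))%:C%C.
  rewrite -(is_cderiveE _ _ _ _ (hw A)).
  have -> : w^~ A = fun y => \sum_f w y (basis_mx f) * (\prod_j A j (f j))%:C%C.
    by apply/funext => y; rewrite multilinearE.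
  apply: is_cderiveE; apply: is_cderive_sum => f.
  have := is_cderiveM _ _ _ _ _ _ (hw (basis_mx f)) (is_cderive_cst x v (\prod_j A j (f j))%:C%C).
  by rewrite mulr0 addr0.
rewrite e; have := @is_cderive_sum x v _ (index_enum _) predT _ _
  (fun f => is_cderiveM _ _ _ _ _ _ (hw (basis_mx f))
     (is_cderive_real _ _ _ _ (is_derive_prod _ _ _ _ _ (fun j => hB j (f j))))).
congr is_cderive; rewrite big_split/= dwE; congr (_ + _).
under [RHS]eq_bigr do rewrite multilinearE//.
rewrite exchange_big/=; apply: eq_bigr => f _.
rewrite rmorph_sum big_distrr/=; apply: eq_bigr => j _; congr (_ * _%:C%C).
by apply: eq_bigr => i _; rewrite !mxE; case: eqP => [->|].
Qed.

End ComplexDerivative.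

(** * Charts *)

Section Jacobian.
Context {R : realType}.

Lemma jacobian_comp (m n q : nat) (f : 'rV[R]_m -> 'rV[R]_n) (g : 'rV[R]_n -> 'rV[R]_q) x :
  differentiable f x -> differentiable g (f x) ->
  jacobian (g \o f) x = jacobian f x *m jacobian g (f x).
Proof.
move=> df dg; apply/row_matrixP => i; rewrite [LHS]rowE [RHS]rowE.
have e := deriveEjacobian (delta_mx 0 i) (differentiable_comp df dg).
apply: etrans (esym e) _; apply: etrans (derive_compE _ _ _ _ _ _ _ df dg) _.
apply: etrans (deriveEjacobian _ dg) _; rewrite (deriveEjacobian _ df).
by rewrite mulmxA.
Qed.

Lemma near_eq_jacobian (m n : nat) (f g : 'rV[R]_m -> 'rV[R]_n) x :
  (\near x, f x = g x) -> differentiable f x -> jacobian f x = jacobian g x.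
Proof.
move=> fg df; have dg := near_eq_differentiable _ _ _ _ _ fg df.
apply/row_matrixP => i; rewrite [LHS]rowE [RHS]rowE.
have e1 := deriveEjacobian (delta_mx 0 i) df.
have e2 := deriveEjacobian (delta_mx 0 i) dg.
exact: etrans (esym e1) (etrans (near_eq_derive _ fg) e2).
Qed.

Lemma jacobian_id (m : nat) (f : 'rV[R]_m -> 'rV[R]_m) x : (\near x, f x = x) ->
  differentiable f x /\ jacobian f x = 1%:M.
Proof.
move=> fid.
have idf : \near x, id x = f x by apply: filterS fid => y ->.
have did : differentiable (@id 'rV[R]_m) x by [].
split; first exact: near_eq_differentiable idf did.
rewrite -(near_eq_jacobian _ _ _ _ _ idf did); apply/row_matrixP => i.
by rewrite !rowE -deriveEjacobian// derive_id mulmx1.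
Qed.

End Jacobian.

Section Manifold.
Context {R : realType}.

Section Charts.
Context {m : nat} {M : manifoldType R m}.

Lemma chart_image_chart (p q : M) : chart_dom p q -> chart_image p (chart p q).
Proof. by move=> pq; exists q. Qed.

Lemma chart_image_self (p : M) : chart_image p (chart p p).
Proof. exact/chart_image_chart/chart_dom_self. Qed.

Lemma chart_dom_unchart (p : M) x : chart_image p x -> chart_dom p (unchart p x).
Proof. by move=> [q pq <-]; rewrite chartK. Qed.

Lemma unchartK (p : M) x : chart_image p x -> chart p (unchart p x) = x.
Proof. by move=> [q pq <-]; rewrite chartK. Qed.

Lemma nbhs_chart_image (p : M) x : chart_image p x -> nbhs x (chart_image p).
Proof. by move=> px; apply: open_nbhs_nbhs; split=> //; exact: chart_image_open. Qed.

Lemma near_unchart (p q : M) (U : set M) : chart_dom p q -> open U -> U q ->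
  \forall x \near chart p q, U (unchart p x).
Proof.
move=> pq oU Uq; have c := @unchart_continuous _ _ _ p _ (chart_image_chart p q pq).
apply: (c U); apply: open_nbhs_nbhs; split => //; by rewrite chartK.
Qed.

Lemma transition_differentiable (p q r : M) : chart_dom p q -> chart_dom r q ->
  differentiable (chart r \o unchart p) (chart p q).
Proof.
move=> pq rq; have [+ _] := @chart_transition _ _ M p r 1.
by apply; exists q.
Qed.

Lemma dunchartE (p q : M) : chart_dom p q ->
  dunchart p (chart p q) = jacobian (chart q \o unchart p) (chart p q).
Proof. by move=> pq; rewrite /dunchart chartK. Qed.

Lemma transition_id (p q : M) : chart_dom p q -> 
  \forall x \near chart p q, (chart p \o unchart p) x = x.
Proof.
move=> /chart_image_chart /nbhs_chart_image; apply: filterS => x.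
exact: unchartK.
Qed.

Lemma transition_comp (p q r s : M) : chart_dom p q -> chart_dom r q -> chart_dom s q ->
  jacobian (chart s \o unchart p) (chart p q) =
  jacobian (chart r \o unchart p) (chart p q) *m jacobian (chart s \o unchart r) (chart r q).
Proof.
move=> pq rq sq; have e : (chart r \o unchart p) (chart p q) = chart r q by rewrite /= chartK.
have d1 := transition_differentiable p q r pq rq.
have d2 : differentiable (chart s \o unchart r) ((chart r \o unchart p) (chart p q)).
  by rewrite e; exact: transition_differentiable.
have d := transition_differentiable p q s pq sq.
rewrite -e; apply: etrans (jacobian_comp _ _ _ _ _ _ d1 d2).
apply: near_eq_jacobian => //.
have := near_unchart p q _ pq (@chart_dom_open _ _ _ r) rq.
by apply: filterS => x h /=; rewrite chartK.
Qed.

Lemma dchartK (p q : M) : chart_dom p q -> dchart p q *m dunchart p (chart p q) = 1%:M.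
Proof.
move=> pq; have qq := chart_dom_self q; rewrite dunchartE// /dchart -transition_comp//.
by have [_ ->] := jacobian_id _ _ _ (transition_id q q qq).
Qed.

Lemma dunchartK (p q : M) : chart_dom p q -> dunchart p (chart p q) *m dchart p q = 1%:M.
Proof. by move=> /dchartK/mulmx1C. Qed.

Lemma dchart_self (p : M) : dchart p p = 1%:M.
Proof. exact: (jacobian_id _ _ _ (transition_id p p (chart_dom_self p))).2. Qed.

Lemma dunchart_self (p : M) : dunchart p (chart p p) = 1%:M.
Proof. by have := dunchartK p p (chart_dom_self p); rewrite dchart_self mulmx1. Qed.

End Charts.

Section MDiff.
Context {m n : nat} {M : manifoldType R m} {N : manifoldType R n}.

(** Continuity is included because charts are total functions, meaningless off their domains: it
    makes [f] send a neighbourhood of [q] into the domain of the chart at [f q]. *)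
Definition mdiff (f : M -> N) (q : M) :=
  {for q, continuous f} /\
  differentiable (chart (f q) \o f \o unchart q) (chart q q).

Lemma near_unchart_map (f : M -> N) (p q : M) (U : set N) : chart_dom p q ->
  {for q, continuous f} -> open U -> U (f q) ->
  \forall x \near chart p q, U (f (unchart p x)).
Proof.
move=> pq fc oU Uq.
have : nbhs q (f @^-1` U) by apply: fc; exact: open_nbhs_nbhs.
rewrite nbhsE => -[W [oW Wq] WU].
by have := near_unchart p q W pq oW Wq; apply: filterS => x /WU.
Qed.

(** Factor through the charts centred at [q] and [f q], where [tangent_map] is defined, and apply
    the chain rule. Jacobians act on the right, hence the order of the factors. *)
Lemma mdiff_in_charts (f : M -> N) (p q : M) (r : N) : mdiff f q ->
  chart_dom p q -> chart_dom r (f q) ->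
  differentiable (chart r \o f \o unchart p) (chart p q) /\
  jacobian (chart r \o f \o unchart p) (chart p q) =
    dunchart p (chart p q) *m tangent_map f q *m dchart r (f q).
Proof.
move=> [fc fd] pq rfq; have qq := chart_dom_self q; have fqq := chart_dom_self (f q).
pose g1 : _ -> 'rV[R]_m := chart q \o unchart p.
pose g2 := chart (f q) \o f \o unchart q.
pose g3 : _ -> 'rV[R]_n := chart r \o unchart (f q).
have e1 : g1 (chart p q) = chart q q by rewrite /g1/= chartK.
have e2 : g2 (chart q q) = chart (f q) (f q) by rewrite /g2/= chartK.
have d1 : differentiable g1 (chart p q) by exact: transition_differentiable.
have d2 : differentiable g2 (g1 (chart p q)) by rewrite e1.
have e21 : g2 (g1 (chart p q)) = chart (f q) (f q) by rewrite e1.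
have d3 : differentiable g3 (g2 (g1 (chart p q))).
  by rewrite e21; exact: transition_differentiable.
have d21 : differentiable (g2 \o g1) (chart p q) := differentiable_comp d1 d2.
have d : differentiable (g3 \o (g2 \o g1)) (chart p q) := differentiable_comp d21 d3.
have near_e : \forall x \near chart p q,
    (g3 \o (g2 \o g1)) x = (chart r \o f \o unchart p) x.
  have n1 := near_unchart p q _ pq (@chart_dom_open _ _ _ q) qq.
  have n2 := near_unchart_map f p q _ pq fc (@chart_dom_open _ _ _ (f q)) fqq.
  apply: filterS2 n1 n2 => x h1 h2.
  by rewrite /g3 /g2 /g1 /= (chartK q)// chartK.
split; first exact: near_eq_differentiable near_e d.
apply: etrans (esym (near_eq_jacobian _ _ _ _ _ near_e d)) _.
apply: etrans (jacobian_comp _ _ _ _ _ _ d21 d3) _.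
rewrite [(g2 \o g1) (chart p q)]e21 (jacobian_comp _ _ _ _ _ _ d1 d2) e1.
by rewrite dunchartE.
Qed.

End MDiff.

Lemma mdiff_comp {m n q} {M : manifoldType R m} {N : manifoldType R n} {P : manifoldType R q}
    (f : M -> N) (g : N -> P) (x : M) : mdiff f x -> mdiff g (f x) ->
  tangent_map (g \o f) x = tangent_map f x *m tangent_map g (f x).
Proof.
move=> [fc fd] [gc gd]; have xx := chart_dom_self x.
pose g1 := chart (f x) \o f \o unchart x.
pose g2 := chart (g (f x)) \o g \o unchart (f x).
have e1 : g1 (chart x x) = chart (f x) (f x) by rewrite /g1/= chartK.
have d2 : differentiable g2 (g1 (chart x x)) by rewrite e1.
have d : differentiable (g2 \o g1) (chart x x) := differentiable_comp fd d2.
have near_e : \forall y \near chart x x,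
    (g2 \o g1) y = (chart (g (f x)) \o (g \o f) \o unchart x) y.
  have := near_unchart_map f x x _ xx fc (@chart_dom_open _ _ _ (f x)) (chart_dom_self _).
  by apply: filterS => y h; rewrite /g2 /g1/= chartK.
apply: etrans (esym (near_eq_jacobian _ _ _ _ _ near_e d)) _.
apply: etrans (jacobian_comp _ _ _ _ _ _ fd d2) _.
by rewrite [(chart (f x) \o f \o unchart x) (chart x x)]e1.
Qed.

Lemma tangent_map_id {m} {M : manifoldType R m} (x : M) : tangent_map id x = 1%:M.
Proof. exact: (jacobian_id _ _ _ (transition_id x x (chart_dom_self x))).2. Qed.

End Manifold.

(** * The left invariant frame *)

Section LieGroup.
Context {R : realType} {m : nat} {G : lieGroupType R m}.

Definition mul_chart (p : G) (z : 'rV[R]_m * 'rV[R]_m) : 'rV[R]_m :=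
  chart p (unchart p z.1 * unchart (1%g : G) z.2)%g.

Definition mul_chart_dom (p : G) : set ('rV[R]_m * 'rV[R]_m) :=
  [set z | [/\ chart_image p z.1, chart_image (1%g : G) z.2
             & chart_dom p (unchart p z.1 * unchart (1%g : G) z.2)%g]].

Lemma open_mul_dom (p q r : G) :
  open [set z : 'rV[R]_m * 'rV[R]_m | [/\ chart_image p z.1, chart_image q z.2
                 & chart_dom r (unchart p z.1 * unchart q z.2)%g]].
Proof.
rewrite openE => -[x y] /= [px qy rxy].
have c : {for (x, y), continuous (fun z : 'rV[R]_m * 'rV[R]_m => unchart p z.1 * unchart q z.2)%g}.
  apply: (@continuous_comp _ _ _ (fun z : 'rV[R]_m * 'rV[R]_m => (unchart p z.1, unchart q z.2))
    (fun z : G * G => z.1 * z.2)%g); last exact: mulg_continuous.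
  apply: cvg_pair => /=.
    apply: (@cvg_comp _ _ _ fst (unchart p) _ (nbhs x)); first exact: cvg_fst.
    exact: unchart_continuous.
  apply: (@cvg_comp _ _ _ snd (unchart q) _ (nbhs y)); first exact: cvg_snd.
  exact: unchart_continuous.
have n1 : nbhs (x, y) [set z : 'rV[R]_m * 'rV[R]_m | chart_dom r (unchart p z.1 * unchart q z.2)%g].
  by apply: c; apply: open_nbhs_nbhs; split => //; exact: chart_dom_open.
have n2 : nbhs (x, y) [set z : 'rV[R]_m * 'rV[R]_m | chart_image p z.1].
  by apply: (@cvg_fst _ _ (nbhs x) (nbhs y)); exact: nbhs_chart_image.
have n3 : nbhs (x, y) [set z : 'rV[R]_m * 'rV[R]_m | chart_image q z.2].
  by apply: (@cvg_snd _ _ (nbhs x) (nbhs y)); exact: nbhs_chart_image.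
by apply: filterS3 n1 n2 n3 => z h1 h2 h3; split.
Qed.

Lemma left_mdiff (g q : G) : mdiff (fun x : G => (g * x)%g) q.
Proof.
split.
  apply: (@continuous_comp _ _ _ (fun x => (g, x)) (fun z : G * G => z.1 * z.2)%g);
    last exact: mulg_continuous.
  by apply: cvg_pair; [exact: cvg_cst|exact: cvg_id].
have [+ _] := Ck_slice_r _ _ _ 1 _ _ (chart g g) (open_mul_dom g q (g * q)%g)
  (@mulg_smooth R m G g q (g * q)%g 1).
move=> /(_ (chart q q)); rewrite /= !chartK; try exact: chart_dom_self.
by apply; split; [exact: chart_image_self|exact: chart_image_self|exact: chart_dom_self].
Qed.

Lemma dleftM (g h p : G) : dleft (g * h)%g p = dleft h p *m dleft g (h * p)%g.
Proof.
rewrite /dleft.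
have -> : (fun x : G => (g * h * x)%g) = (fun x => (g * x)%g) \o (fun x => (h * x)%g).
  by apply/funext => x /=; rewrite mulgA.
by rewrite mdiff_comp//; exact: left_mdiff.
Qed.

Lemma dleft1 (p : G) : dleft 1%g p = 1%:M.
Proof.
rewrite /dleft; have -> : (fun x : G => (1 * x)%g) = id by apply/funext => x; rewrite mul1g.
exact: tangent_map_id.
Qed.

Lemma dleftK (g : G) : dleft g 1%g *m dleft g^-1%g g = 1%:M.
Proof. by have := dleftM g^-1%g g 1%g; rewrite mulVg mulg1 dleft1. Qed.

Definition left_frame (p : G) (x : 'rV[R]_m) : 'M[R]_m :=
  dleft (unchart p x) 1%g *m dchart p (unchart p x).

Lemma left_frameE (p : G) v x :
  vfield_in_chart (left_vfield v) p x = v *m left_frame p x.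
Proof. by rewrite /vfield_in_chart /left_vfield mulmxA. Qed.

Lemma left_frame_self (p : G) : left_frame p (chart p p) = dleft p 1%g.
Proof.
by rewrite /left_frame chartK ?dchart_self ?mulmx1//; exact: chart_dom_self.
Qed.

Let z0 : 'rV[R]_m := chart (1%g : G) 1%g.

Lemma unchart_z0 : unchart (1%g : G) z0 = 1%g.
Proof. by rewrite chartK//; exact: chart_dom_self. Qed.

(** Left translation by [q] is the product with its first factor fixed. The frame is thus a
    directional derivative of the smooth multiplication map, which makes left invariant fields
    smooth. *)
Lemma left_frame_derive (p : G) v x : chart_image p x ->
  v *m left_frame p x = 'D_(0, v) (mul_chart p) (x, z0).
Proof.
move=> px; set q := unchart p x.
have pq : chart_dom p q by exact: chart_dom_unchart.
have pq1 : chart_dom p (q * 1)%g by rewrite mulg1.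
have [d1 e1] := mdiff_in_charts (fun y => (q * y)%g) 1%g 1%g p
  (left_mdiff q 1%g) (chart_dom_self _) pq1.
have [d2 _] : Ck 1 (mul_chart_dom p) (mul_chart p) by exact: mulg_smooth.
have Ux : mul_chart_dom p (x, z0).
  by split => //=; [exact: chart_image_self|rewrite unchart_z0 mulg1].
have dp y : differentiable (fun y : 'rV[R]_m => (x, y)) y by exact: differentiable_pair.
have := derive_compE _ _ _ _ (mul_chart p) z0 v (dp z0) (d2 _ Ux).
rewrite derive_pair_cst_r => <-.
have e2 := deriveEjacobian v d1; rewrite e1 dunchart_self mul1mx mulg1 in e2.
exact: esym e2.
Qed.

Lemma left_vfield_smooth v : smooth_vfield (left_vfield (G := G) v).
Proof.
move=> p k; have [_ /(_ (0, v))] : Ck k.+1 (mul_chart_dom p) (mul_chart p) by exact: mulg_smooth.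
have oU : open (mul_chart_dom p) by exact: open_mul_dom.
move=> /(Ck_slice _ _ _ _ _ _ z0 oU) h.
have h' := Ck_sub _ _ _ (chart_image p) _ _ h.
apply: Ck_eq (h' _); first exact: chart_image_open.
  by move=> x; rewrite inE => px; rewrite left_frameE -left_frame_derive.
move=> x px; split => //=; first exact: chart_image_self.
by rewrite unchart_z0 mulg1; exact: chart_dom_unchart.
Qed.

Definition left_chart (p : G) (z : 'rV[R]_m) : 'rV[R]_m :=
  chart p (p * unchart (1%g : G) z)%g.

Lemma left_chart_jacobian (p r : G) : chart_dom (1%g : G) r -> chart_dom p (p * r)%g ->
  differentiable (left_chart p) (chart (1%g : G) r) /\
  jacobian (left_chart p) (chart (1%g : G) r) =
    dunchart (1%g : G) (chart (1%g : G) r) *m dleft p r *m dchart p (p * r)%g.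
Proof. exact: mdiff_in_charts (left_mdiff p r). Qed.

Lemma left_frame_chart (p r : G) : chart_dom p r ->
  left_frame p (chart p r) = dleft r 1%g *m dchart p r.
Proof. by move=> pr; rewrite /left_frame chartK. Qed.

(** The left invariance of the frame, read between the charts at 1 and at [p]. It holds at all [r]
    near 1 and can therefore be differentiated. *)
Lemma left_frame_mul (p r : G) : chart_dom (1%g : G) r -> chart_dom p (p * r)%g ->
  left_frame p (left_chart p (chart (1%g : G) r)) =
  left_frame 1%g (chart (1%g : G) r) *m jacobian (left_chart p) (chart (1%g : G) r).
Proof.
move=> r1 pr; rewrite (left_chart_jacobian p r r1 pr).2.
have e : left_chart p (chart (1%g : G) r) = chart p (p * r)%g.
  by rewrite /left_chart chartK.
rewrite e.
rewrite (left_frame_chart p _ pr).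
rewrite (left_frame_chart 1%g _ r1).
rewrite dleftM mulg1.
have aux (a b c d f : 'M[R]_m) : b *m c = 1%:M ->
    a *m d *m f = a *m b *m (c *m d *m f).
  by move=> bc; rewrite !mulmxA -(mulmxA a b c) bc mulmx1.
exact: aux (dchartK _ _ r1).
Qed.

Lemma near_left_chart (p : G) : \forall z \near z0,
  exists r, [/\ z = chart (1%g : G) r, chart_dom (1%g : G) r & chart_dom p (p * r)%g].
Proof.
have oo := chart_dom_self (1%g : G).
have n1 : nbhs z0 (chart_image (1%g : G)) by exact/nbhs_chart_image/chart_image_self.
have p1 : chart_dom p (p * 1)%g by rewrite mulg1; exact: chart_dom_self.
have n2 := near_unchart_map (fun y : G => (p * y)%g) 1%g 1%g _ oo (left_mdiff p 1%g).1
  (@chart_dom_open _ _ _ p) p1.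
apply: filterS2 n1 n2 => z zi pz; exists (unchart (1%g : G) z); split => //.
  by rewrite unchartK.
exact: chart_dom_unchart.
Qed.

End LieGroup.

(** * Matrix-valued functions *)

Section MatrixDerivative.
Context {R : realType} {V : normedModType R}.

Definition mx_derive {m n} (x v : V) (F : V -> 'M[R]_(m, n)) (dF : 'M[R]_(m, n)) :=
  forall i j, is_derive x v (fun y => F y i j : R^o) (dF i j).

Lemma mx_deriveE {m n} x v (F : V -> 'M[R]_(m, n)) dF :
  mx_derive x v F dF -> 'D_v F x = dF.
Proof.
move=> h; have dv : derivable F x v by apply/derivable_mxP => i j; case: (h i j).
by rewrite derive_mx//; apply/matrixP => i j; rewrite mxE; case: (h i j).
Qed.

Lemma derivable_mx_derive {m n} x v (F : V -> 'M[R]_(m, n)) :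
  derivable F x v -> mx_derive x v F ('D_v F x).
Proof.
move=> dv i j; rewrite derive_mx// mxE; apply: derivableP.
by move/derivable_mxP: dv; apply.
Qed.

Lemma mx_derive_near {m n} x v (F F' : V -> 'M[R]_(m, n)) dF :
  (\near x, F x = F' x) -> mx_derive x v F dF -> mx_derive x v F' dF.
Proof.
move=> FF h i j; apply: near_eq_is_derive (h i j).
by apply: filterS FF => y ->.
Qed.

Lemma mx_derive_cst {m n} x v (A : 'M[R]_(m, n)) : mx_derive x v (fun=> A) 0.
Proof. by move=> i j; rewrite mxE; exact: is_derive_cst. Qed.

Lemma mx_derive_mul {m n q} x v (Y : V -> 'M[R]_(m, n)) (A : V -> 'M[R]_(n, q)) dY dA :
  mx_derive x v Y dY -> mx_derive x v A dA ->
  mx_derive x v (fun y => Y y *m A y) (dY *m A x + Y x *m dA).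
Proof.
move=> hY hA i j.
have h := is_derive_sum (fun k => is_derive_mulr _ _ _ _ _ _ (hY i k) (hA k j)).
have -> : (fun y => (Y y *m A y) i j : R^o) =
   \sum_(k < n) (fun y => Y y i k * A y k j : R^o).
  by apply/funext => y; rewrite mxE fct_sumE.
by apply: (is_derive_eq h); rewrite !mxE -big_split.
Qed.

Lemma Ck_coord {m n} k (U : set V) (F : V -> 'M[R]_(m, n)) i j : open U ->
  Ck k U F -> Ck k U (fun x => F x i j : R^o).
Proof.
move=> oU; elim: k F => [|k IH] F.
  move=> Fc x Ux; apply: (@continuous_comp _ _ _ F (fun A : 'M[R]_(m, n) => A i j : R^o)).
    exact: Fc.
  exact/differentiable_continuous/differentiable_coord.
move=> [Fd FD]; split=> [x Ux|v].
  exact: (differentiable_comp (Fd x Ux) (differentiable_coord (F x) i j)).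
apply: Ck_eq (IH _ (FD v)) => // x; rewrite inE => Ux.
by rewrite derive_mx ?mxE//; exact/diff_derivable/Fd.
Qed.

Lemma derive_mx_symmetric {m n} (F : V -> 'M[R]_(m, n)) (U : set V) x u v :
  open U -> U x -> Ck 2 U F ->
  'D_v (fun z => 'D_u F z) x = 'D_u (fun z => 'D_v F z) x.
Proof.
move=> oU Ux F2; have [Fd FD] := F2.
have e a b i j : ('D_b (fun z => 'D_a F z) x) i j =
    'D_b (fun z => 'D_a (fun y => F y i j : R^o) z : R^o) x.
  have [dd _] := FD a.
  rewrite derive_mx ?mxE; last exact/diff_derivable/dd.
  apply: near_eq_derive; apply: filterS (open_nbhs_nbhs (conj oU Ux)) => y Uy.
  by rewrite derive_mx ?mxE//; exact/diff_derivable/Fd.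
apply/matrixP => i j; apply: etrans (e u v i j) (etrans _ (esym (e v u i j))).
apply: (derive_symmetric _ _ U) => //.
exact: Ck_coord.
Qed.

End MatrixDerivative.

(** * The bracket of left invariant fields *)

Section Bracket.
Context {R : realType} {m : nat} {G : lieGroupType R m}.

Lemma left_frame_differentiable (p : G) (v : 'rV[R]_m) x : chart_image p x ->
  differentiable (fun x => v *m left_frame p x) x.
Proof.
move=> px; have [+ _] := @left_vfield_smooth R m G v p 1.
have -> : vfield_in_chart (left_vfield v) p = fun x => v *m left_frame p x.
  by apply/funext => y; rewrite left_frameE.
exact.
Qed.

(** The derivative of the frame matrix, assembled by rows because smoothness is known for each left
    invariant field. *)
Definition dframe (p : G) (a : 'rV[R]_m) : 'M[R]_m :=
  \matrix_i 'D_a (fun x => delta_mx 0 i *m left_frame p x) (chart p p).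

Lemma dframeP (p : G) a : mx_derive (chart p p) a (left_frame p) (dframe p a).
Proof.
move=> i j; rewrite !mxE.
have dd := left_frame_differentiable p (delta_mx 0 i) _ (chart_image_self p).
have := derivable_mx_derive _ _ _ (diff_derivable (v := a) dd) ord0 j.
by congr is_derive; apply/funext => x; rewrite -rowE mxE.
Qed.

Lemma dframe_row (p : G) a (v : 'rV[R]_m) :
  mx_derive (chart p p) a (fun x => v *m left_frame p x) (v *m dframe p a).
Proof.
have := mx_derive_mul _ _ _ _ _ _ (mx_derive_cst (chart p p) a v) (dframeP p a).
by rewrite mul0mx add0r.
Qed.

Lemma dframe_linear (p : G) a b (x y : 'rV[R]_m) :
  dframe p (a *: x + b *: y) = a *: dframe p x + b *: dframe p y.
Proof.
apply/row_matrixP => i.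
have rl (A B : 'M[R]_m) : row i (a *: A + b *: B) = a *: row i A + b *: row i B.
  by apply/rowP => j; rewrite !mxE.
have dd := left_frame_differentiable p (delta_mx 0 i) _ (chart_image_self p).
have dE w : row i (dframe p w) =
    'd (fun x => delta_mx 0 i *m left_frame p x) (chart p p) w.
  by apply: etrans (deriveE w dd); exact: rowK.
apply: etrans (dE _) _; apply: etrans _ (esym (rl _ _)).
apply: etrans (linearP _ a x (b *: y)) _.
congr (a *: _ + _).
  exact: esym (dE x).
by rewrite linearZ -[RHS]/(b *: _); congr (b *: _); exact: esym (dE y).
Qed.

Lemma left_bracketE (p : G) (u v : 'rV[R]_m) :
  vfield_bracket (left_vfield u) (left_vfield v) p =
  v *m dframe p (u *m dleft p 1%g) - u *m dframe p (v *m dleft p 1%g).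
Proof.
have e w : vfield_in_chart (left_vfield w) p = fun x => w *m left_frame p x.
  by apply/funext => y; rewrite left_frameE.
by rewrite /vfield_bracket !e !(mx_deriveE _ _ _ _ (dframe_row _ _ _)).
Qed.

Lemma lie_bracketE (u v : 'rV[R]_m) :
  lie_bracket G u v = v *m dframe (1%g : G) u - u *m dframe (1%g : G) v.
Proof. by rewrite /lie_bracket left_bracketE !dleft1 !mulmx1. Qed.

Let z0 : 'rV[R]_m := chart (1%g : G) 1%g.

Lemma left_chart_Ck (p : G) k : exists U : set 'rV[R]_m,
  [/\ open U, U z0 & Ck k U (left_chart p)].
Proof.
have pp := chart_dom_self p.
exists [set y | mul_chart_dom p (chart p p, y)]; split.
- exact/open_slice_r/open_mul_dom.
- split => /=; [exact: chart_image_self|exact: chart_image_self|].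
  by rewrite !chartK ?mulg1//; exact: chart_dom_self.
- have := Ck_slice_r _ _ _ k _ _ (chart p p) (open_mul_dom p 1%g p) (@mulg_smooth R m G p 1%g p k).
  by congr Ck; apply/funext => y /=; rewrite chartK.
Qed.

Lemma left_bracket_invariant (p : G) u v :
  vfield_bracket (left_vfield u) (left_vfield v) p = lie_bracket G u v *m dleft p 1%g.
Proof.
have [U [oU Uz LC]] := left_chart_Ck p 2.
have [Ld LD] := LC.
have pp := chart_dom_self p; have oo := chart_dom_self (1%g : G).
have p1 : chart_dom p (p * 1)%g by rewrite mulg1.
have [_ jacL] := left_chart_jacobian p 1%g oo p1.
rewrite dunchart_self mul1mx mulg1 dchart_self mulmx1 -/z0 in jacL.
have Lz0 : left_chart p z0 = chart p p by rewrite /left_chart unchart_z0 mulg1.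
have DL w : 'D_w (left_chart p) z0 = w *m dleft p 1%g.
  by rewrite -jacL; exact: (deriveEjacobian w (Ld _ Uz)).
have nU : nbhs z0 U := open_nbhs_nbhs (conj oU Uz).
(* The second derivative of left translation by [p], as a matrix depending on one direction. *)
pose dJ w : 'M[R]_m := \matrix_i 'D_w (fun z => 'D_(delta_mx 0 i) (left_chart p) z) z0.
have dJP w : mx_derive z0 w (jacobian (left_chart p)) (dJ w).
  move=> i j; rewrite mxE.
  have [dd _] := LD (delta_mx 0 i).
  have := derivable_mx_derive _ _ _ (diff_derivable (v := w) (dd _ Uz)) ord0 j.
  apply: near_eq_is_derive; apply: filterS nU => z Uz'.
  by rewrite (deriveEjacobian (delta_mx 0 i) (Ld _ Uz')) -rowE mxE.
have dJE (a b : 'rV[R]_m) : b *m dJ a = 'D_a (fun z => 'D_b (left_chart p) z) z0.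
  have := mx_derive_mul _ _ _ _ _ _ (mx_derive_cst z0 a b) (dJP a).
  rewrite mul0mx add0r => h; symmetry; apply: mx_deriveE.
  apply: mx_derive_near h; apply: filterS nU => z Uz'.
  by rewrite (deriveEjacobian b (Ld _ Uz')).
(* The derivative of [left_frame_mul] along [a] at the identity. The last term is symmetric in [a]
   and [b] and drops out of the bracket. *)
have key (a b : 'rV[R]_m) : b *m dframe p (a *m dleft p 1%g) =
    b *m dframe (1%g : G) a *m dleft p 1%g + b *m dJ a.
  have h1 := mx_derive_mul _ _ _ _ _ _ (dframe_row (1%g : G) a b) (dJP a).
  rewrite -/z0 jacL [left_frame _ _]left_frame_self dleft1 mulmx1 in h1.
  rewrite -(mx_deriveE _ _ _ _ h1) -(mx_deriveE _ _ _ _ (dframe_row p _ b)).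
  have fd := left_frame_differentiable p b _ (chart_image_self p).
  rewrite -DL -Lz0.
  have fd' : differentiable (fun x => b *m left_frame p x) (left_chart p z0) by rewrite Lz0.
  rewrite -(derive_compE _ _ _ _ _ _ a (Ld _ Uz) fd').
  apply: near_eq_derive; have := near_left_chart p; apply: filterS => z [r [-> r1 pr]].
  exact: etrans (congr1 (mulmx b) (left_frame_mul p r r1 pr)) (mulmxA _ _ _).
have cancel (a b d f : 'rV[R]_m) (X : 'M[R]_m) : d = f ->
    a *m X + d - (b *m X + f) = (a - b) *m X.
  by move=> ->; rewrite mulmxBl opprD addrACA subrr addr0.
have sym : v *m dJ u = u *m dJ v.
  apply: etrans (dJE u v) (etrans _ (esym (dJE v u))).
  exact: derive_mx_symmetric oU Uz LC.
apply: etrans (left_bracketE p u v) _.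
apply: etrans (congr2 (fun a b => a - b) (key u v) (key v u)) _.
apply: etrans (cancel _ _ _ _ _ sym) _.
by rewrite lie_bracketE.
Qed.

End Bracket.

(** * The Lie algebra *)

Section Coordinate.
Context {R : realType} {m : nat} {G : lieGroupType R m}.
Let z0 : 'rV[R]_m := chart (1%g : G) 1%g.

(** With [g = c (t g) a] and [h = c (t h) b], moving [a] past [c (t h)] conjugates it, and by
    normality it stays in [H]. *)
Lemma semidirect_coordinateM (c : R -> G) (H : set G) (t : G -> R) :
  normal_subgroup H -> (forall s u, c (s + u) = (c s * c u)%g) ->
  semidirect_coordinate c H t -> forall g h, t (g * h)%g = t g + t h.
Proof.
move=> [[H1 HM HV] HN] cD [_ tH tE] g h.
pose a := ((c (t g))^-1 * g)%g; pose b := ((c (t h))^-1 * h)%g.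
have -> : (g * h)%g = (c (t g + t h) * ((c (t h))^-1 * a * (c (t h))^-1^-1 * b))%g.
  by rewrite cD /a /b invgK !mulgA !mulgK mulgV mul1g.
by apply: tE; apply: HM (tH h); exact/HN/tH.
Qed.

Lemma smooth_fun_differentiable (t : G -> R) (p : G) x :
  smooth_fun (t : G -> R^o) -> chart_image p x ->
  differentiable ((t : G -> R^o) \o unchart p) x.
Proof. by move=> ts; have [td _] := ts p 1; exact: td. Qed.

Lemma derive_left_chart (p : G) w :
  differentiable (left_chart p) z0 /\ 'D_w (left_chart p) z0 = w *m dleft p 1%g.
Proof.
have oo := chart_dom_self (1%g : G); have pp := chart_dom_self p.
have p1 : chart_dom p (p * 1)%g by rewrite mulg1.
have [Ld jacL] := left_chart_jacobian p 1%g oo p1.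
rewrite dunchart_self mul1mx mulg1 dchart_self mulmx1 in jacL.
split; first exact: Ld.
by rewrite -jacL; exact: (deriveEjacobian w Ld).
Qed.

(** Near the identity [t (p r) = t p + t r], so [dt] is left invariant. *)
Lemma derive_homomorphism (t : G -> R) (p : G) u :
  smooth_fun (t : G -> R^o) -> (forall g h, t (g * h)%g = t g + t h) ->
  'D_(u *m dleft p 1%g) ((t : G -> R^o) \o unchart p) (chart p p) =
  'D_u ((t : G -> R^o) \o unchart (1%g : G)) z0.
Proof.
move=> ts tM; have [Ld DL] := derive_left_chart p u.
have Lz0 : left_chart p z0 = chart p p by rewrite /left_chart unchart_z0 mulg1.
have td := smooth_fun_differentiable t p _ ts (chart_image_self p).
have t1 := smooth_fun_differentiable t 1%g _ ts (chart_image_self (1%g : G)).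
rewrite -DL -Lz0; rewrite -Lz0 in td.
apply: etrans (esym (derive_compE _ _ _ _ _ _ u Ld td)) _.
have e : 'D_u (fun z => t p + ((t : G -> R^o) \o unchart (1%g : G)) z : R^o) z0 =
         'D_u ((t : G -> R^o) \o unchart (1%g : G)) z0.
  have hd := diff_derivable (v := u) t1.
  by apply: etrans (deriveD (derivable_cst _ _ _) hd) _; rewrite derive_cst add0r.
apply: etrans _ e; apply: near_eq_derive.
have := near_left_chart p; apply: filterS => z [r [-> r1 pr]].
by rewrite /= /left_chart !chartK// tM.
Qed.

(** Used with [b = 1] for [e0] and with [b = 0] for directions in the Lie algebra of [H]. *)
Lemma derive_one_parameter (t : G -> R) v (c : R -> G) (b : R) :
  smooth_fun (t : G -> R^o) -> one_parameter_subgroup v c ->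
  (forall s, t (c s) = b * s) -> 'D_v ((t : G -> R^o) \o unchart (1%g : G)) z0 = b.
Proof.
move=> ts [[cc cs] cD cv] tc.
have c0 : c 0 = 1%g by apply: (mulIg (c 0)); rewrite -cD addr0 mul1g.
have [cd _] := cs 1%g 1%N.
have dom0 : chart_dom (1%g : G) (c 0) by rewrite c0; exact: chart_dom_self.
have {}cd : differentiable (chart (1%g : G) \o c : R^o -> _) 0 by exact: cd.
have e0 : (chart (1%g : G) \o c) 0 = z0 by rewrite /= c0.
have t1 := smooth_fun_differentiable t 1%g _ ts (chart_image_self (1%g : G)).
have t1' : differentiable ((t : G -> R^o) \o unchart (1%g : G)) ((chart (1%g : G) \o c) 0).
  by rewrite e0.
have ve : 'D_1 (chart (1%g : G) \o c : R^o -> _) 0 = v.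
  by rewrite -cv /velocity c0 derive1E.
have h := derive_compE _ _ _ _ _ _ (1 : R^o) cd t1'.
rewrite ve e0 in h.
apply: etrans (esym h) _.
have e : 'D_1 (fun s : R^o => b * s : R^o) (0 : R^o) = b.
  have hb := is_deriveZ b (is_derive_id (0 : R^o) 1).
  by rewrite -[LHS]/('D_1 (b \*: (id : R^o -> R^o)) 0) derive_val; exact: mulr1.
apply: etrans _ e; apply: near_eq_derive.
have : nbhs (0 : R^o) [set s | chart_dom (1%g : G) (c s)].
  by apply: (cc 0); apply: open_nbhs_nbhs; split=> //; exact: chart_dom_open.
by apply: filterS => s sd; rewrite /= chartK.
Qed.

End Coordinate.

(** * The adjoint representation and its traces *)

Section Trace.
Context {R : realType} {m : nat} {G : lieGroupType R m}.

Definition ad_mx (u : 'rV[R]_m) : 'M[R]_m := lin1_mx (lie_bracket G u).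

Lemma lie_bracket_linear_r (u : 'rV[R]_m) a b x y :
  lie_bracket G u (a *: x + b *: y) = a *: lie_bracket G u x + b *: lie_bracket G u y.
Proof.
have aux (D : 'rV[R]_m -> 'M[R]_m) : D (a *: x + b *: y) = a *: D x + b *: D y ->
    (a *: x + b *: y) *m D u - u *m D (a *: x + b *: y) =
    a *: (x *m D u - u *m D x) + b *: (y *m D u - u *m D y).
  move=> ->; rewrite mulmxDl mulmxDr -!scalemxAl -!scalemxAr.
  by rewrite !scalerBr opprD addrACA.
apply: etrans (lie_bracketE _ _) (etrans (aux _ (dframe_linear _ _ _ _ _)) _).
by congr (_ *: _ + _ *: _); rewrite lie_bracketE.
Qed.

Lemma lie_bracketN (u v : 'rV[R]_m) : lie_bracket G u v = - lie_bracket G v u.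
Proof. by rewrite (lie_bracketE u) (lie_bracketE v) opprB. Qed.

Lemma lie_bracket_linear_l (u : 'rV[R]_m) a b x y :
  lie_bracket G (a *: x + b *: y) u = a *: lie_bracket G x u + b *: lie_bracket G y u.
Proof.
rewrite lie_bracketN lie_bracket_linear_r (lie_bracketN x) (lie_bracketN y).
by rewrite opprD !scalerN.
Qed.

Lemma mul_lin1_mx_of (f : 'rV[R]_m -> 'rV[R]_m) v :
  (forall a b x y, f (a *: x + b *: y) = a *: f x + b *: f y) -> v *m lin1_mx f = f v.
Proof.
move=> fl; have f0 : f 0 = 0 by have := fl 0 0 0 0; rewrite !scale0r addr0.
rewrite [in RHS](row_sum_delta v) mulmx_sum_row.
symmetry; apply: (big_ind2 (fun a b => f a = b)) => //.
  by move=> x1 y1 x2 y2 <- <-; have := fl 1 1 x1 x2; rewrite !scale1r.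
move=> i _; have := fl (v 0 i) 0 (delta_mx 0 i) 0.
rewrite !scale0r !addr0 => ->; congr (_ *: _).
by apply/rowP => j; rewrite !mxE.
Qed.

Lemma mul_ad_mx u v : v *m ad_mx u = lie_bracket G u v.
Proof. exact: mul_lin1_mx_of (lie_bracket_linear_r u). Qed.

Lemma lin1_mx_comb (f g h : 'rV[R]_m -> 'rV[R]_m) a b :
  (forall y, h y = a *: f y + b *: g y) -> lin1_mx h = a *: lin1_mx f + b *: lin1_mx g.
Proof. by move=> hE; apply/matrixP => i j; rewrite !mxE hE !mxE. Qed.

Lemma ad_mx_linear a b x y : ad_mx (a *: x + b *: y) = a *: ad_mx x + b *: ad_mx y.
Proof. by apply: lin1_mx_comb => u; exact: lie_bracket_linear_l. Qed.

Lemma lin1_mx_mulmx (f : 'rV[R]_m -> 'rV[R]_m) (J : 'M[R]_m) :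
  lin1_mx (fun y => f y *m J) = lin1_mx f *m J.
Proof.
apply/matrixP => i j; rewrite !mxE.
by apply: eq_bigr => l _; rewrite !mxE.
Qed.

Lemma trJadE (J : G -> 'M[R]_m) u : trJad J u = \tr (ad_mx u *m J 1%g).
Proof. by rewrite /ad_mx -lin1_mx_mulmx. Qed.

Lemma koszulE (J : G -> 'M[R]_m) u : unimodular G -> koszul J u = trJad J u.
Proof. by move=> un; rewrite /koszul un subr0. Qed.

Lemma trJad_linear (J : G -> 'M[R]_m) a b x y :
  trJad J (a *: x + b *: y) = a * trJad J x + b * trJad J y.
Proof.
have aux (A B X : 'M[R]_m) :
    \tr ((a *: A + b *: B) *m X) = a * \tr (A *m X) + b * \tr (B *m X).
  by rewrite mulmxDl -!scalemxAl linearD !linearZ.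
apply: etrans (trJadE _ _) _.
apply: etrans (congr1 (fun X => \tr (X *m J 1%g)) (ad_mx_linear a b x y)) _.
exact: etrans (aux _ _ _) (esym (congr2 (fun c d => a * c + b * d) (trJadE J x) (trJadE J y))).
Qed.

Lemma nijenhuis_lie_bracket (J : G -> 'M[R]_m) u v :
  complex_structure J -> left_invariant_endo J ->
  lie_bracket G u v + (lie_bracket G (u *m J 1%g) v + lie_bracket G u (v *m J 1%g)) *m J 1%g
  - lie_bracket G (u *m J 1%g) (v *m J 1%g) = 0.
Proof.
move=> [_ _ N] Ji.
have e w : vfield_mul J (left_vfield w) = left_vfield (w *m J 1%g).
  apply/funext => g; rewrite /vfield_mul /left_vfield -!mulmxA.
  by have := Ji g 1%g; rewrite mulg1 => ->.
have := N _ _ (left_vfield_smooth u) (left_vfield_smooth v) 1%g.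
by rewrite /nijenhuis (e u) (e v).
Qed.

End Trace.

(** * Invariant forms *)

Section Closed.
Context {R : realType} {m : nat} {G : lieGroupType R m}.
Local Notation C := R[i].

Lemma setrow_mul k (j : 'I_k) (x : 'rV[R]_m) (A : 'M[R]_(k, m)) (M : 'M[R]_m) :
  setrow j x A *m M = setrow j (x *m M) (A *m M).
Proof.
apply/row_matrixP => i; rewrite row_mul.
have [->|ij] := eqVneq i j; first by rewrite !row_setrow.
by rewrite !row_setrow_neq// row_mul.
Qed.

Lemma row'_mul k (j : 'I_k) (A : 'M[R]_(k, m)) (M : 'M[R]_m) :
  row' j (A *m M) = row' j A *m M.
Proof.
apply/matrixP => a b; rewrite !mxE; apply: eq_bigr => l _; by rewrite !mxE.
Qed.

Lemma type_k0_form k (J : G -> 'M[R]_m) (sigma : G -> 'M[R]_(k, m) -> C) p :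
  type_k0 J sigma -> type_form (J p) (sigma p).
Proof.
move=> ty i x A; apply: (ty p _ _ i); first by rewrite !row_setrow.
by rewrite !row'_setrow.
Qed.

Lemma form_in_chart_self k (sigma : G -> 'M[R]_(k, m) -> C) (p : G) B :
  form_in_chart sigma p (chart p p) B = sigma p B.
Proof.
by rewrite /form_in_chart dunchart_self mulmx1 chartK//; exact: chart_dom_self.
Qed.

Lemma left_invariant_form_at k (sigma : G -> 'M[R]_(k, m) -> C) (p : G) V :
  left_invariant_form sigma -> sigma p (V *m dleft p 1%g) = sigma 1%g V.
Proof. by move=> inv; have := inv p 1%g V; rewrite mulg1. Qed.

Lemma left_frame_form k (sigma : G -> 'M[R]_(k, m) -> C) (p : G) x V :
  left_invariant_form sigma -> chart_image p x ->
  form_in_chart sigma p x (V *m left_frame p x) = sigma 1%g V.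
Proof.
move=> inv [q pq <-]; rewrite -(left_invariant_form_at _ _ q V inv).
have -> : form_in_chart sigma p (chart p q) (V *m left_frame p (chart p q)) =
    sigma q (V *m left_frame p (chart p q) *m dunchart p (chart p q)).
  by rewrite /form_in_chart (chartK p q pq).
have aux (a b c : 'M[R]_m) : b *m c = 1%:M -> V *m (a *m b) *m c = V *m a.
  by move=> bc; rewrite -!mulmxA bc mulmx1.
have e : V *m left_frame p (chart p q) *m dunchart p (chart p q) = V *m dleft q 1%g.
  apply: etrans _ (aux (dleft q 1%g) _ _ (dchartK p q pq)).
  exact (congr1 (fun X : 'M[R]_m => V *m X *m dunchart p (chart p q)) (left_frame_chart p q pq)).
exact (congr1 (sigma q) e).
Qed.

(** The endomorphism [N u] at [p]: minus the derivative of the frame, expressed in the frame itself,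
    since [dleft p^-1 p] inverts [dleft p 1]. *)
Definition left_derivation (p : G) (u : 'rV[R]_m) : 'M[R]_m :=
  - (dframe p (u *m dleft p 1%g) *m dleft p^-1%g p).

(** Along the frame sigma is constant, so the derivative of its coefficients on fixed arguments is
    minus the contribution of the moving frame. *)
Lemma is_cderive_left_form k (sigma : G -> 'M[R]_(k, m) -> C) (p : G) u V :
  smooth_form sigma -> left_invariant_form sigma ->
  is_cderive (chart p p) (u *m dleft p 1%g)
    (fun x => form_in_chart sigma p x (V *m dleft p 1%g))
    (derivation_form (sigma 1%g) (left_derivation p u) V).
Proof.
move=> [alt sm] inv; set x0 := chart p p; set a := u *m dleft p 1%g.
have px0 : chart_image p x0 by exact: chart_image_self.
have ml1 : multilinear (sigma 1%g) by have /alternating_formE[] := alt 1%g.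
have mlS y : multilinear (form_in_chart sigma p y).
  have /alternating_formE[ml _] := alt (unchart p y).
  move=> i x z b c A; rewrite /form_in_chart !setrow_mul mulmxDl -!scalemxAl.
  exact: ml.
pose dS A := cderive (fun x => form_in_chart sigma p x A) x0 a.
have dSP A : is_cderive x0 a (fun x => form_in_chart sigma p x A) (dS A).
  have [/(_ 1%N)[reD _] /(_ 1%N)[imD _]] := sm p A.
  by split; apply: derivableP; apply: diff_derivable; [exact: reD|exact: imD].
have := mx_derive_mul _ _ _ _ _ _ (mx_derive_cst x0 a V) (dframeP p a).
rewrite mul0mx add0r => dB.
have h1 := multilinear_product_rule _ _ _ _ _ _ _ _ mlS dSP dB.
have h0 : is_cderive x0 a (fun y => form_in_chart sigma p y (V *m left_frame p y)) 0.
  apply: is_cderive_near (is_cderive_cst x0 a (sigma 1%g V)).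
  apply: filterS (nbhs_chart_image p x0 px0) => y py.
  by rewrite left_frame_form.
have := is_cderiveE _ _ _ _ h1; rewrite (is_cderiveE _ _ _ _ h0).
rewrite [left_frame p x0]left_frame_self => /esym/eqP; rewrite addr_eq0 => /eqP e.
suff <- : dS (V *m dleft p 1%g) = derivation_form (sigma 1%g) (left_derivation p u) V.
  exact: dSP.
rewrite e -sumrN; apply: eq_bigr => j _.
rewrite [form_in_chart _ _ _ _]form_in_chart_self.
have VK : V = V *m dleft p 1%g *m dleft p^-1%g p.
  have aux (b c : 'M[R]_m) : b *m c = 1%:M -> V = V *m b *m c.
    by move=> bc; rewrite -mulmxA bc mulmx1.
  exact: aux (dleftK p).
(* Translation by the inverse of [p] brings the terms back to the identity. *)
rewrite -(inv p^-1%g p) mulVg setrow_mul -VK row_mul -multilinearN//.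
congr (sigma _ (setrow _ _ _)).
by rewrite /left_derivation mulmxN mulmxA.
Qed.

(** The last hypothesis reads [df = f lam], with [lam] the left invariant form [- i/2 Tr (J ad u)].
    Hence [f] factors out of [d (f sigma)], and left translation reduces the rest to forms on the
    Lie algebra. *)
Lemma closed_twisted_form k (J : G -> 'M[R]_m) (sigma : G -> 'M[R]_(k.+1, m) -> C)
    (f : G -> C) :
  (m = k.+1 + k.+1)%N -> unimodular G -> complex_structure J -> left_invariant_endo J ->
  smooth_form sigma -> type_k0 J sigma -> left_invariant_form sigma ->
  (forall p u, is_cderive (chart p p) (u *m dleft p 1%g) (f \o unchart p)
     (f p * ((- ('i / 2) * (trJad J u)%:C)%C))) ->
  closed_form (fun p A => f p * sigma p A).
Proof.
move=> mE un Jc Ji sm ty inv fD p A.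
set F0 := dleft p 1%g; set T0 := dleft p^-1%g p.
have FT : F0 *m T0 = 1%:M by exact: dleftK.
have [V ->] : exists V, A = V *m F0.
  by exists (A *m T0); rewrite -mulmxA (mulmx1C FT) mulmx1.
pose lam u := (- ('i / 2) * (\tr (ad_mx (G := G) u *m J 1%g))%:C)%C.
pose h u B := derivation_form (sigma 1%g) (left_derivation p u) B + lam u * sigma 1%g B.
have term i : cderive (fun x => form_in_chart (fun p A => f p * sigma p A) p x (row' i (V *m F0)))
    (chart p p) (row i (V *m F0)) = f p * h (row i V) (row' i V).
  rewrite row'_mul row_mul.
  have dh := is_cderiveM _ _ _ _ _ _ (fD p (row i V))
    (is_cderive_left_form _ sigma p (row i V) (row' i V) sm inv).
  apply: etrans (is_cderiveE _ _ _ _ dh) _.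
  rewrite form_in_chart_self left_invariant_form_at// /= chartK ?trJadE; last exact: chart_dom_self.
  by rewrite /h /lam; ring.
have -> : ext_derivative (fun p A => f p * sigma p A) p (V *m F0) = f p * antisymmetrize h V.
  rewrite /ext_derivative /antisymmetrize mulr_sumr; apply: eq_bigr => i _.
  by rewrite [RHS]mulrCA -term.
rewrite (closed_invariant_form _ (J 1%g) _ (@ad_mx R m G)) ?mulr0//.
- by have [_ JJ _] := Jc; exact: JJ.
- by have [alt _] := sm; exact: alt.
- exact: type_k0_form.
- move=> a b x y.
  have aux (D : 'rV[R]_m -> 'M[R]_m) (F T : 'M[R]_m) :
      (forall a b x y, D (a *: x + b *: y) = a *: D x + b *: D y) ->
      - (D ((a *: x + b *: y) *m F) *m T) = a *: - (D (x *m F) *m T) + b *: - (D (y *m F) *m T).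
    by move=> Dl; rewrite mulmxDl -!scalemxAl Dl mulmxDl -!scalemxAl opprD !scalerN.
  exact: aux (dframe_linear p).
- move=> u v.
  have aux (D : 'rV[R]_m -> 'M[R]_m) (w : 'rV[R]_m) (F T : 'M[R]_m) : F *m T = 1%:M ->
      v *m D (u *m F) - u *m D (v *m F) = w *m F ->
      w = u *m - (D (v *m F) *m T) - v *m - (D (u *m F) *m T).
    move=> FT1 /(congr1 (fun X : 'rV[R]_m => X *m T)).
    by rewrite -[w *m F *m T]mulmxA FT1 mulmx1 mulmxBl !mulmxN opprK !mulmxA addrC => <-.
  apply: etrans (mul_ad_mx u v) _; apply: aux FT _.
  exact: etrans (esym (left_bracketE p u v)) (left_bracket_invariant p u v).
- move=> u v.
  apply: etrans _ (nijenhuis_lie_bracket J u v Jc Ji).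
  apply: (congr2 (fun a b : 'rV[R]_m => a - b)); last exact (mul_ad_mx _ _).
  apply: (congr2 (fun a b : 'rV[R]_m => a + b)); first exact (mul_ad_mx _ _).
  apply: (congr1 (fun a : 'rV[R]_m => a *m J 1%g)).
  by apply: (congr2 (fun a b : 'rV[R]_m => a + b)); exact (mul_ad_mx _ _).
Qed.

End Closed.

(** * The exponential factor *)

Section Twist.
Context {R : realType}.
Local Notation C := R[i].

Lemma cexp_imaginary (a b : R) : cexp (- ('i / 2)%C * a%:C%C * b%:C%C) =
  (cos (- (a / 2) * b) +i* sin (- (a / 2) * b))%C.
Proof.
have -> : - ('i / 2)%C * a%:C%C * b%:C%C = (0 +i* (- (a / 2) * b))%C :> C.
  rewrite complex_splitE rmorphM rmorphN rmorphM fmorphV rmorph_nat.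
  by rewrite add0r; ring.
by rewrite /cexp expR0 !mul1r.
Qed.

Lemma is_cderive_cis (V : normedModType R) (x v : V) (s : V -> R^o) :
  differentiable s x ->
  is_cderive x v (fun y => (cos (s y) +i* sin (s y))%C)
    ((cos (s x) +i* sin (s x))%C * ('i * ('D_v s x)%:C%C)).
Proof.
have mulE (a b d : R) : (a +i* b)%C * ('i * d%:C%C) = (- b * d +i* (a * d))%C.
  by rewrite -complexiE; apply/eqP; rewrite eq_complex/=; apply/andP; split; apply/eqP; ring.
move=> sd; rewrite mulE; split => /=.
  have h := derivableP (diff_derivable (v := v)
    (differentiable_comp sd (differentiable_cos (s x)))).
  by apply: (is_derive_eq h); exact: derive_cos_comp.
have h := derivableP (diff_derivable (v := v)
  (differentiable_comp sd (differentiable_sin (s x)))).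
by apply: (is_derive_eq h); exact: derive_sin_comp.
Qed.

Lemma smooth_form_cis k m (M : manifoldType R m) (w : M -> 'M[R]_(k, m) -> C) (s : M -> R) :
  smooth_form w -> smooth_fun (s : M -> R^o) ->
  smooth_form (fun p A => (cos (s p) +i* sin (s p))%C * w p A).
Proof.
move=> [alt sm] ss; split=> [p|p A].
  have [ml al] := alt p; split=> [A B D i b c eA eB eD|A i j ij e].
    by rewrite (ml A B D i b c)//; ring.
  by rewrite (al A i j)// mulr0.
have oU := @chart_image_open R m M p; have [sr si] := sm p A.
split=> j; have [Cc Cs] := Ck_cos_sin j _ _ oU (ss p j).
  have h := CkD _ _ _ _ _ oU (CkM _ _ _ _ oU Cc (sr j))
    (CkM _ _ _ _ oU (Ck_cst _ _ _ (-1 : R^o)) (CkM _ _ _ _ oU Cs (si j))).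
  by apply: Ck_eq h => // x _; rewrite /form_in_chart Re_mul /= mulN1r.
have h := CkD _ _ _ _ _ oU (CkM _ _ _ _ oU Cc (si j)) (CkM _ _ _ _ oU Cs (sr j)).
by apply: Ck_eq h => // x _; rewrite /form_in_chart Im_mul.
Qed.

End Twist.

(** Under unimodularity psi is [Tr (J ad)]. Both psi and [psi(e0) dt] vanish on the kernel of psi,
    where [t] is zero along one-parameter subgroups of [H], and they agree at [e0]. *)
Lemma derive_coordinate (R : realType) (m : nat) (G : lieGroupType R m) (J : G -> 'M[R]_m)
  (G_unim : unimodular G)
  (e0 : 'rV[R]_m)
  (e0_compl : forall x, exists! a : R, koszul J (x - a *: e0) = 0)
  (H : set G) (H_normal : normal_subgroup H)
  (H_lie : lie_algebra_of H = [set x | koszul J x = 0])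
  (c : R -> G) (c_exp : one_parameter_subgroup e0 c)
  (t : G -> R) (t_coord : semidirect_coordinate c H t) p u :
  'D_(u *m dleft p 1%g) ((t : G -> R^o) \o unchart p) (chart p p) * trJad J e0 = trJad J u.
Proof.
have [_ cD _] := c_exp; have [ts tH tE] := t_coord; have [[H1 _ _] _] := H_normal.
rewrite derive_homomorphism//; last exact: semidirect_coordinateM t_coord.
set T := (t : G -> R^o) \o unchart (1%g : G).
have Td : differentiable T (chart (1%g : G) 1%g).
  exact: smooth_fun_differentiable (chart_image_self _).
(* [a] is the component of [u] along [e0]; it is identified below with [dt(u)]. *)
have [a [ka _]] := e0_compl u.
have T0 : 'D_e0 T (chart (1%g : G) 1%g) = 1.
  apply: (derive_one_parameter t e0 c) => // s.
  by rewrite mul1r -[c s]mulg1; exact: tE.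
have Tk : 'D_(u - a *: e0) T (chart (1%g : G) 1%g) = 0.
  have : lie_algebra_of H (u - a *: e0) by rewrite H_lie.
  move=> [d [d_exp dH]]; apply: (derive_one_parameter t _ d) => // s.
  have [_ dD _] := d_exp; have [_ cD0 _] := c_exp.
  have c0 : c 0 = 1%g by apply: (mulIg (c 0)); rewrite -cD0 addr0 mul1g.
  by rewrite mul0r -[d s]mul1g -c0; apply: tE.
have -> : 'D_u T (chart (1%g : G) 1%g) = a.
  have e : 'D_u T (chart (1%g : G) 1%g) =
      'D_(u - a *: e0) T (chart (1%g : G) 1%g) + a * 'D_e0 T (chart (1%g : G) 1%g).
    rewrite !(deriveE _ Td) -[a * _]/(a *: _) -linearZ -linearD.
    by rewrite subrK.
  by rewrite e Tk T0 add0r mulr1.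
move: ka; rewrite koszulE// -scaleNr -[u in trJad J (u + _)]scale1r trJad_linear mul1r mulNr.
by move/eqP; rewrite subr_eq0 => /eqP.
Qed.

Theorem proposition5p10 (R : realType) (n : nat)
  (G : lieGroupType R (2 * n)) (J : G -> 'M[R]_(2 * n))
  (G_sc : simply_connected R G)
  (G_solv : solvable_group G)
  (G_unim : unimodular G)
  (J_cplx : complex_structure J)
  (J_inv : left_invariant_endo J)
  (psi_neq0 : exists x, koszul J x <> 0)
  (psi_br : forall x y, koszul J (lie_bracket G x y) = 0)
  (e0 : 'rV[R]_(2 * n))
  (e0_compl : forall x, exists! a : R, koszul J (x - a *: e0) = 0)
  (H : set G)
  (H_normal : normal_subgroup H)
  (H_conn : connected H)
  (H_lie : lie_algebra_of H = [set x | koszul J x = 0])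
  (c : R -> G) (c_exp : one_parameter_subgroup e0 c)
  (t : G -> R) (t_coord : semidirect_coordinate c H t)
  (sigma : G -> 'M[R]_(n, 2 * n) -> R[i])
  (sigma_form : smooth_form sigma)
  (sigma_type : type_k0 J sigma)
  (sigma_inv : left_invariant_form sigma) :
  let tau := fun (p : G) (A : 'M[R]_(n, 2 * n)) =>
    cexp (- ('i / 2)%C * (trJad J e0)%:C%C * (t p)%:C%C) * sigma p A in
  [/\ smooth_form tau, type_k0 J tau & closed_form tau].
Proof.
have [ts _ _] := t_coord.
(* The exponent is purely imaginary, equal to [i s], so the factor is [cos s + i sin s]. *)
pose s (p : G) : R := - (trJad J e0 / 2) * t p.
have ss : smooth_fun (s : G -> R^o).
  move=> p k; have h := CkM k _ _ _ (@chart_image_open R _ G p)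
    (Ck_cst _ k _ (- (trJad J e0 / 2) : R^o)) (ts p k).
  exact: h.
move=> tau.
have -> : tau = fun p A => (cos (s p) +i* sin (s p))%C * sigma p A.
  by apply/funext => p; apply/funext => A; rewrite /tau cexp_imaginary.
split; first exact: smooth_form_cis.
  by move=> p A B i rAB r'AB; rewrite (sigma_type p A B i rAB r'AB) mulrCA.
(* In dimension 0 every trace vanishes, against [psi_neq0]; otherwise the degree is a successor. *)
case: n => [|k] in G J G_sc G_solv G_unim J_cplx J_inv psi_neq0 psi_br e0 e0_compl H H_normal
  H_conn H_lie c c_exp t t_coord sigma sigma_form sigma_type sigma_inv tau ts s ss *.
  have [x []] := psi_neq0; rewrite koszulE// trJadE /mxtrace big1// => -[i i0].
  by exfalso; rewrite muln0 in i0.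
apply: (@closed_twisted_form _ _ G k J) => //; first by rewrite mul2n addnn.
move=> p u.
have sd := smooth_fun_differentiable s p _ ss (chart_image_self p).
have td := smooth_fun_differentiable t p _ ts (chart_image_self p).
have h := is_cderive_cis _ _ (u *m dleft p 1%g) _ sd.
(* Here [psi = psi(e0) dt] turns the constant [Tr (J ad e0)] into the value at an arbitrary [u] that
   [closed_twisted_form] requires. *)
have Ds : 'D_(u *m dleft p 1%g) ((s : G -> R^o) \o unchart p) (chart p p) = - (trJad J u / 2).
  rewrite -(derive_coordinate _ _ _ J G_unim e0 e0_compl H H_normal H_lie c c_exp t t_coord p).
  have hz := is_deriveZ (- (trJad J e0 / 2))
    (derivableP (diff_derivable (v := u *m dleft p 1%g) td)).
  apply: etrans (@derive_val _ _ _ _ _ _ _ hz) _.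
  by rewrite -[LHS]/(_ * _); ring.
rewrite Ds /= chartK in h; last exact: chart_dom_self.
move: h; congr is_cderive; congr (_ * _).
by rewrite rmorphN rmorphM fmorphV rmorph_nat; ring.
Qed.
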